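(* Let $k=\mathbb F_q$ be a finite field, let $x\in\mathbb P^1=\mathbb P^1_{\mathbb F_q}$ be a closed point of degree $d$, and let $\mathcal E=\bigoplus_{i=1}^n\mathcal O(d_i)$ and $\mathcal E'=\bigoplus_{i=1}^n\mathcal O(d_i')$ be rank $n$ vector bundles on $\mathbb P^1$ with $d_1\le\dots\le d_n$ and $d_1'\le\dots\le d_n'$. Suppose that $d_i'=d_i-\epsilon_i$, where $\epsilon_i\in\{0,1,\dots,d\}$ for all $i\in\{1,\dots,n\}$ and $\sum_{i=1}^n\epsilon_i=d$. Let $A:=\{i\in\{1,\dots,n\}\mid\epsilon_i\ne0\}$, $s:=\min(A)$ and $B:=\max(A)$. Then $\mathcal E'$ is a Hecke modification of $\mathcal E$ at $x$ with weight $1$ if and only if $$d_{j+1}-\epsilon_{j+1}\le d_j\quad\text{for all }j\in\{s,s+1,\dots,B-1\}.$$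
   Context: A vector bundle $\mathcal E'$ is a Hecke modification of $\mathcal E$ at $x$ with weight $1$ if there is a short exact sequence of coherent sheaves $0\to\mathcal E'\to\mathcal E\to\mathcal K_x\to0$, where $\mathcal K_x$ is the skyscraper sheaf at $x$ whose stalk is the residue field $\kappa(x)$. The degree of $x$ is $[\kappa(x):\mathbb F_q]$. *)

(* Defs.v *)
From HB Require Import structures.
From mathcomp Require Import all_boot all_order all_algebra.
From mathcomp Require Import boolp classical_sets functions cardinality.
From mathcomp Require Import topology.

Set Implicit Arguments.
Unset Strict Implicit.
Unset Printing Implicit Defensive.

Import Order.TTheory GRing.Theory Num.Theory.

Local Open Scope classical_set_scope.
Local Open Scope ring_scope.

Notation "x %:F" := (@FracField.tofrac _ x) : ring_scope.

(* The scheme P^1 over k, with function field K = k('X): its points are the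
   generic point, the closed points of the affine line Spec k['X] (the nonzero
   primes, each generated by a unique monic irreducible polynomial), and the
   point at infinity.  Its nonempty open sets are the cofinite sets containing
   the generic point. *)

Notation funfield k := {fraction {poly k}}.

Record monic_irreducible (k : fieldType) := MonicIrreducible {
  mi_poly :> {poly k};
  mi_monic : mi_poly \is monic;
  mi_irr : irreducible_poly mi_poly }.

Inductive P1 (k : fieldType) :=
  | Generic
  | Finite of monic_irreducible k
  | Infinity.
Arguments Generic {k}.
Arguments Finite {k} _.
Arguments Infinity {k}.

HB.instance Definition _ (k : fieldType) := gen_eqMixin (P1 k).
HB.instance Definition _ (k : fieldType) := gen_choiceMixin (P1 k).

Definition zariski_open (k : fieldType) : set (set (P1 k)) :=
  [set U | U !=set0 -> U Generic /\ finite_set (~` U)].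

Lemma zariski_openT k : @zariski_open k setT.
Proof. by move=> _; split=> //; rewrite setCT; exact: finite_set0. Qed.

Lemma zariski_openI k : setI_closed (@zariski_open k).
Proof.
move=> U V oU oV [x [Ux Vx]].
have [UG fU] : U Generic /\ finite_set (~` U) by apply: oU; exists x.
have [VG fV] : V Generic /\ finite_set (~` V) by apply: oV; exists x.
by split=> //; rewrite setCI finite_setU.
Qed.

Lemma zariski_open_bigU k (I : Type) (f : I -> set (P1 k)) :
  (forall i, zariski_open (f i)) -> zariski_open (\bigcup_i f i).
Proof.
move=> of_ [x [i _ fix_]].
have [fG ff] : f i Generic /\ finite_set (~` f i) by apply: of_; exists x.
split; first by exists i.
by apply: sub_finite_set ff => y nfy fy; apply: nfy; exists i.
Qed.

HB.instance Definition _ (k : fieldType) :=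
  isOpenTopological.Build (P1 k) (@zariski_openT k) (@zariski_openI k)
    (@zariski_open_bigU k).

Record opens (T : topologicalType) := Opens {
  oset :> set T;
  oset_open : open oset }.

Section LocalRings.
Variable k : fieldType.
Local Notation K := (funfield k).
Implicit Types (x : P1 k) (f g : K) (a b c d : {poly k}).

(* At infinity the valuation of a / b is deg b - deg a. *)
Definition local_ring x : set K :=
  match x with
  | Generic => setT
  | Finite p => [set f | exists a b, ~~ (p %| b)%R /\ f = a%:F / b%:F]
  | Infinity => [set f | exists a b,
      [/\ b != 0, (size a <= size b)%N & f = a%:F / b%:F]]
  end.

Definition max_ideal x : set K :=
  match x with
  | Generic => [set 0]
  | Finite p =>
      [set f | exists a b, [/\ (p %| a)%R, ~~ (p %| b)%R & f = a%:F / b%:F]]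
  | Infinity => [set f | exists a b,
      [/\ b != 0, (size a < size b)%N & f = a%:F / b%:F]]
  end.

Lemma tofrac_neq0 a : (a%:F != 0) = (a != 0).
Proof. by rewrite tofrac_eq0. Qed.

Lemma ndvd_neq0 (p a : {poly k}) : ~~ (p %| a)%R -> a != 0.
Proof. by apply: contraNneq => ->; rewrite dvdp0. Qed.

Lemma ndvdM (p : monic_irreducible k) b d :
  ~~ (p %| b)%R -> ~~ (p %| d)%R -> ~~ (p %| b * d)%R.
Proof.
rewrite -!(irreducible_poly_coprime _ (mi_irr p)) => pb pd.
by rewrite coprimepMr pb.
Qed.

Lemma fracB a b c d : b != 0 -> d != 0 ->
  a%:F / b%:F - c%:F / d%:F = (a * d - c * b)%:F / (b * d)%:F :> K.
Proof.
move=> b0 d0; rewrite tofracB !tofracM -mulNr addf_div ?tofrac_neq0 //.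
by rewrite !mulNr.
Qed.

Lemma fracM a b c d :
  (a%:F / b%:F) * (c%:F / d%:F) = (a * c)%:F / (b * d)%:F :> K.
Proof. by rewrite mulf_div !tofracM. Qed.

Lemma size_mulX a b c d : b != 0 -> d != 0 ->
  (size a <= size b)%N -> (size c <= size d)%N ->
  (size (a * c)%R <= size (b * d)%R)%N.
Proof.
move=> b0 d0 ab cd; rewrite (size_mul b0 d0).
by apply: leq_trans (size_polyMleq a c) _; rewrite -!subn1 leq_sub2r // leq_add.
Qed.

Lemma size_mulXlt a b c d : b != 0 -> d != 0 ->
  (size a <= size b)%N -> (size c < size d)%N ->
  (size (a * c)%R < size (b * d)%R)%N.
Proof.
move=> b0 d0 ab cd; rewrite (size_mul b0 d0).
have d1 : (0 < size d)%N by rewrite (leq_ltn_trans _ cd).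
have b1 : (0 < size b)%N by rewrite size_poly_gt0.
apply: leq_ltn_trans (size_polyMleq a c) _.
case: (size b) b1 ab => // nb _ ab; case: (size d) d1 cd => // nd _ cd.
rewrite addSn addnS /=.
have h : (size a + size c <= nb.+1 + nd)%N by rewrite leq_add.
by apply: leq_ltn_trans (_ : (_ <= nb + nd)%N) _ => //; rewrite -subn1 leq_subLR.
Qed.

Lemma local_ringB x f g : local_ring x f -> local_ring x g ->
  local_ring x (f - g).
Proof.
case: x => [|p|] //=.
- move=> [a [b [pb ->]]] [c [d [pd ->]]].
  rewrite fracB ?(ndvd_neq0 pb) ?(ndvd_neq0 pd) //.
  by exists (a * d - c * b), (b * d); split=> //; exact: ndvdM.
- move=> [a [b [b0 ab ->]]] [c [d [d0 cd ->]]]; rewrite fracB //.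
  exists (a * d - c * b), (b * d); split; rewrite ?mulf_neq0 //.
  rewrite (leq_trans (size_polyD _ _)) // size_polyN geq_max.
  by rewrite size_mulX // [c * b]mulrC size_mulX.
Qed.

Lemma local_ringM x f g : local_ring x f -> local_ring x g ->
  local_ring x (f * g).
Proof.
case: x => [|p|] //=.
- move=> [a [b [pb ->]]] [c [d [pd ->]]]; rewrite fracM.
  by exists (a * c), (b * d); split=> //; exact: ndvdM.
- move=> [a [b [b0 ab ->]]] [c [d [d0 cd ->]]]; rewrite fracM.
  by exists (a * c), (b * d); split; rewrite ?mulf_neq0 // size_mulX.
Qed.

Lemma local_ringC x (c : k) : local_ring x (c%:P)%:F.
Proof.
case: x => [|p|] //=.
- exists c%:P, 1; split; last by rewrite tofrac1 divr1.
  by rewrite dvdp1; have [] := mi_irr p; case: ltngtP.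
- exists c%:P, 1; split; rewrite ?oner_eq0 //; last by rewrite tofrac1 divr1.
  by rewrite size_poly1 size_polyC leq_b1.
Qed.

Lemma local_ring1 x : local_ring x 1.
Proof. by rewrite -tofrac1 -polyC1; exact: local_ringC. Qed.

Definition local_ring_pred x : {pred K} := fun f => `[< local_ring x f >].

Lemma local_ring_subring x : subring_closed (local_ring_pred x).
Proof.
split.
- by apply/asboolP; exact: local_ring1.
- move=> f g /asboolP fx /asboolP gx; apply/asboolP; exact: local_ringB.
- move=> f g /asboolP fx /asboolP gx; apply/asboolP; exact: local_ringM.
Qed.

HB.instance Definition _ x :=
  GRing.isSubringClosed.Build K (local_ring_pred x) (local_ring_subring x).

Definition stalkO x := {f : K | f \in local_ring_pred x}.
HB.instance Definition _ x := Choice.on (stalkO x).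
HB.instance Definition _ x : SubType _ _ (stalkO x) := SubType.on (stalkO x).
HB.instance Definition _ x := [SubChoice_isSubComNzRing of stalkO x by <:].

Definition max_ideal_pred x : {pred stalkO x} :=
  fun u => `[< max_ideal x (val u) >].
Arguments max_ideal_pred : clear implicits.

Lemma frac_eq1 a b : b != 0 -> a%:F / b%:F = 1 :> K -> a = b.
Proof.
move=> b0 /(congr1 ( *%R^~ b%:F)); rewrite mul1r divfK ?tofrac_neq0 //.
by move/eqP; rewrite tofrac_eq => /eqP.
Qed.

Lemma max_ideal_muladd x f g h : local_ring x f -> max_ideal x g ->
  max_ideal x h -> max_ideal x (f * g + h).
Proof.
case: x => [|p|] /=.
- by move=> _ -> ->; rewrite mulr0 addr0.
- move=> [a [b [pb ->]]] [c [d [pc pd ->]]] [u [v [pu pv ->]]].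
  have pbd := ndvdM pb pd; have pbdv := ndvdM pbd pv.
  rewrite fracM -[u%:F / _]opprK -mulNr -tofracN.
  rewrite (fracB _ _ (ndvd_neq0 pbd) (ndvd_neq0 pv)).
  exists ((a * c) * v - (- u) * (b * d)), ((b * d) * v); split=> //.
  rewrite mulNr opprK; apply: dvdp_add; last by apply: dvdp_mulr.
  by apply: dvdp_mulr; apply: dvdp_mull.
- move=> [a [b [b0 ab ->]]] [c [d [d0 cd ->]]] [u [v [v0 uv ->]]].
  have bd0 : b * d != 0 by rewrite mulf_neq0.
  rewrite fracM -[u%:F / _]opprK -mulNr -tofracN (fracB _ _ bd0 v0).
  exists ((a * c) * v - (- u) * (b * d)), ((b * d) * v).
  split; rewrite ?mulf_neq0 //.
  rewrite (leq_ltn_trans (size_polyD _ _)) // size_polyN gtn_max.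
  apply/andP; split.
    by rewrite [a * c * v]mulrC [b * d * v]mulrC size_mulXlt // size_mulXlt.
  by rewrite [- u * _]mulrC size_mulXlt // size_polyN.
Qed.

Lemma max_ideal_closed x : idealr_closed (max_ideal_pred x).
Proof.
split.
- apply/asboolP; rewrite rmorph0; case: x => [|p|] //=.
  + exists 0, 1; split; rewrite ?dvdp0 ?tofrac0 ?mul0r //.
    by rewrite dvdp1; have [] := mi_irr p; case: ltngtP.
  + exists 0, 1; split; rewrite ?oner_eq0 ?tofrac0 ?mul0r //.
    by rewrite size_poly0 size_poly1.
- apply/asboolPn; rewrite rmorph1; case: x => [|p|] /=.
  + by apply/eqP; rewrite oner_eq0.
  + move=> [a [b [pa pb /esym/(frac_eq1 (ndvd_neq0 pb)) ab]]].
    by rewrite -ab pa in pb.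
  + move=> [a [b [b0 ab /esym/(frac_eq1 b0) eab]]].
    by rewrite eab ltnn in ab.
- move=> f g h /asboolP gx /asboolP hx; apply/asboolP.
  rewrite rmorphD rmorphM; apply: max_ideal_muladd => //.
  exact/asboolP/(valP f).
Qed.

HB.instance Definition _ x :=
  isIdealr.Build (stalkO x) (max_ideal_pred x) (max_ideal_closed x).

Definition residue_field x := {ideal_quot (max_ideal_pred x)}.
HB.instance Definition _ x := GRing.ComNzRing.on (residue_field x).

Definition residue x (u : stalkO x) : residue_field x :=
  \pi_(residue_field x)%qT u.

Lemma residueD x : {morph @residue x : u v / u + v}.
Proof. by move=> u v; rewrite /residue -[RHS]Quotient.pi_add. Qed.

Lemma residueM x : {morph @residue x : u v / u * v}.
Proof. by move=> u v; rewrite /residue -[RHS]Quotient.pi_mul. Qed.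

Lemma residue1 x : residue (1 : stalkO x) = 1.
Proof. by rewrite /residue -[RHS]pi_oner. Qed.

End LocalRings.

(* [kappa(x) : k] = d (e is a basis), with k acting on kappa(x) = O_x / m_x through the
   constant functions. *)
Definition const_stalk (k : fieldType) (x : P1 k) (c : k) : stalkO x :=
  exist _ (c%:P)%:F (asboolT (local_ringC x c)).

Definition has_degree (k : fieldType) (x : P1 k) (d : nat) : Prop :=
  exists e : 'I_d -> residue_field x, forall z : residue_field x,
    exists! c : 'rV[k]_d, z = \sum_i residue (const_stalk x (c 0 i)) * e i.

Definition incl (T : Type) (A B : set T) (h : B `<=` A) (y : B) : A :=
  exist _ (val y) (mem_set (h _ (set_mem (valP y)))).

Section LocallyFractions.
Variable k : fieldType.
Local Notation K := (funfield k).
Implicit Types (L : P1 k -> set K) (U : set (P1 k)).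

(* Sections over U of the sheaf with stalks L x inside K: functions on U with
   values in these stalks that are locally given by one element of K.  Over
   the empty set there is exactly one, as there should be. *)
Definition locally_fraction L U : set (U -> K) :=
  [set s | forall x : U, exists V f, [/\ open_nbhs (val x) V, V `<=` U &
     forall y : U, V (val y) -> L (val y) f /\ s y = f]].

Definition locally_fraction_pred L U : {pred (U -> K)} :=
  fun s => `[< locally_fraction L s >].
Arguments locally_fraction_pred : clear implicits.

Lemma locally_fraction_comp L L1 L2 U (op : K -> K -> K) (s t : U -> K) :
  (forall x f g, L1 x f -> L2 x g -> L x (op f g)) ->
  locally_fraction L1 s -> locally_fraction L2 t ->
  locally_fraction L (fun x => op (s x) (t x)).
Proof.
move=> Lop sL tL x.
have [V [f [[oV Vx] VU Vf]]] := sL x; have [W [g [[oW Wx] WU Wg]]] := tL x.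
exists (V `&` W), (op f g); split.
- by split; [exact: openI | split].
- by move=> y [/VU].
- move=> y [/Vf[Lf ->] /Wg[Lg ->]]; split=> //; exact: Lop.
Qed.

Lemma locally_fraction_cst L U f : open U -> (forall x, L x f) ->
  locally_fraction L (fun _ : U => f).
Proof.
move=> oU Lf x; exists U, f; split=> //; split=> //.
exact/set_mem/(valP x).
Qed.

Lemma locally_fraction_res L (U V : set (P1 k)) (h : V `<=` U) (s : U -> K) :
  open V -> locally_fraction L s -> locally_fraction L (s \o incl h).
Proof.
move=> oV sL x; have [W [f [[oW Wx] WU Wf]]] := sL (incl h x).
exists (W `&` V), f; split.
- split; first exact: openI.
  by split=> //; exact/set_mem/(valP x).
- by move=> y [].
- by move=> y [Wy Vy]; exact: (Wf (incl h y)).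
Qed.

Lemma locally_fraction_mem L U (s : U -> K) (x : U) :
  locally_fraction L s -> L (val x) (s x).
Proof. by case/(_ x)=> V [f [[_ Vx] _ /(_ x Vx)[Lf ->]]]. Qed.

Lemma locally_fraction_local L U (s : U -> K) :
  (forall x : U, exists V, exists h : V `<=` U,
     [/\ open V, V (val x) & locally_fraction L (s \o incl h)]) ->
  locally_fraction L s.
Proof.
move=> sL x; have [V [h [oV Vx /(_ (exist _ (val x) (mem_set Vx)))]]] := sL x.
move=> [W [f [[oW Wx] WV Wf]]]; exists W, f; split=> //.
  by apply: subset_trans WV h.
move=> y Wy; have Vy := WV _ Wy.
have -> : y = incl h (exist _ (val y) (mem_set Vy)) by exact: val_inj.
exact: (Wf (exist _ (val y) (mem_set Vy))).
Qed.

End LocallyFractions.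
Arguments locally_fraction_pred {k} L U.

Section StructureSheaf.
Variable k : fieldType.
Local Notation K := (funfield k).
Implicit Types U V W : opens (P1 k).

Definition regular U : {pred (U -> K)} :=
  locally_fraction_pred (@local_ring k) U.
Arguments regular : clear implicits.

Lemma regular_subring U : subring_closed (regular U).
Proof.
split.
- apply/asboolP; apply: locally_fraction_cst (oset_open U) _ => x.
  exact: local_ring1.
- move=> s t /asboolP sU /asboolP tU; apply/asboolP.
  apply: (locally_fraction_comp (op := fun f g => f - g)) sU tU => x f g.
  exact: local_ringB.
- move=> s t /asboolP sU /asboolP tU; apply/asboolP.
  by apply: (locally_fraction_comp (op := *%R)) sU tU => x f g; exact: local_ringM.
Qed.

HB.instance Definition _ U :=
  GRing.isSubringClosed.Build (U -> K) (regular U) (regular_subring U).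

Definition structure_sheaf U := {s : U -> K | s \in regular U}.
HB.instance Definition _ U := Choice.on (structure_sheaf U).
HB.instance Definition _ U : SubType _ _ (structure_sheaf U) :=
  SubType.on (structure_sheaf U).
HB.instance Definition _ U :=
  GRing.SubChoice_isSubComPzRing.Build _ _ (structure_sheaf U)
    (GRing.subringClosedP (regular U)).

Lemma res_regular U V (h : V `<=` U) (a : structure_sheaf U) :
  (val a \o incl h) \in regular V.
Proof.
apply/asboolP/locally_fraction_res; first exact: oset_open.
exact/asboolP/(valP a).
Qed.

Definition res_fun U V (h : V `<=` U) (a : structure_sheaf U) :
  structure_sheaf V := exist _ (val a \o incl h) (res_regular h a).

Lemma germ_subproof U x (Ux : x \in (U : set _)) (a : structure_sheaf U) :
  val a (exist _ x Ux) \in local_ring_pred x.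
Proof.
apply/asboolP; apply: (@locally_fraction_mem _ (@local_ring k) _ _ (exist _ x Ux)).
exact/asboolP/(valP a).
Qed.

Definition germ U x (Ux : x \in (U : set _)) (a : structure_sheaf U) :
  stalkO x :=
  exist (fun f => f \in local_ring_pred x) _ (germ_subproof Ux a).

End StructureSheaf.

Record omodule (k : fieldType) := OModule {
  sec :> forall U : opens (P1 k), lmodType (structure_sheaf U);
  res : forall U V : opens (P1 k), V `<=` U -> sec U -> sec V;
  res_linear : forall (U V : opens (P1 k)) (h : V `<=` U)
    (a : structure_sheaf U) (s t : sec U),
    res h (a *: s + t) = res_fun h a *: res h s + res h t;
  res_id : forall (U : opens (P1 k)) (h : U `<=` U) (s : sec U), res h s = s;
  res_comp : forall (U V W : opens (P1 k)) (h : V `<=` U) (h' : W `<=` V)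
    (h'' : W `<=` U) (s : sec U), res h' (res h s) = res h'' s;
  sheaf_separated : forall (U : opens (P1 k)) (I : Type) (V : I -> opens (P1 k))
    (h : forall i, V i `<=` U), U `<=` \bigcup_i V i ->
    forall s t : sec U, (forall i, res (h i) s = res (h i) t) -> s = t;
  sheaf_glue : forall (U : opens (P1 k)) (I : Type) (V : I -> opens (P1 k))
    (h : forall i, V i `<=` U), U `<=` \bigcup_i V i ->
    forall s : (forall i, sec (V i)),
    (forall i j (W : opens (P1 k)) (hi : W `<=` V i) (hj : W `<=` V j),
       res hi (s i) = res hj (s j)) ->
    exists t : sec U, forall i, res (h i) t = s i }.

Record ohom (k : fieldType) (E F : omodule k) := OHom {
  app :> forall U : opens (P1 k), {linear E U -> F U};
  app_res : forall (U V : opens (P1 k)) (h : V `<=` U) (s : E U),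
    app V (res h s) = res h (app U s) }.

Definition in_image (k : fieldType) (E F : omodule k) (phi : ohom E F)
    (U : opens (P1 k)) (t : F U) : Prop :=
  forall x, oset U x -> exists (V : opens (P1 k)) (h : V `<=` U) (s : E V),
    oset V x /\ phi V s = res h t.

(* Exactness of 0 -> E' -> E -> Q -> 0 as sheaves: images are sheaf images, so
   psi need not be surjective on sections. *)
Definition short_exact (k : fieldType) (E' E Q : omodule k)
    (phi : ohom E' E) (psi : ohom E Q) : Prop :=
  [/\ forall (U : opens (P1 k)) (s : E' U), phi U s = 0 -> s = 0,
      forall (U : opens (P1 k)) (s : E U), psi U s = 0 <-> in_image phi s &
      forall (U : opens (P1 k)) (t : Q U), in_image psi t].

Section Twist.
Variables (k : fieldType) (m : int).
Local Notation K := (funfield k).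
Implicit Types U V W : opens (P1 k).

(* A form of degree m in X0, X1 divided by X0 ^ m is regular away from
   infinity (X0 = 0), where 'X ^ m = (X1 / X0) ^ m is a generator. *)
Definition twist_stalk (x : P1 k) : set K :=
  if x is Infinity then [set f | local_ring x (('X%:F : K) ^ (- m) * f)]
  else local_ring x.

Lemma twist_stalk_muladd x (a f g : K) : local_ring x a ->
  twist_stalk x f -> twist_stalk x g -> twist_stalk x (a * f + g).
Proof.
have addL y (u v : K) :
    local_ring y u -> local_ring y v -> local_ring y (u + v).
  move=> yu yv; have -> : u + v = u - (v - v - v) by rewrite subrr sub0r opprK.
  by do 3?apply: local_ringB.
case: x => [//|p pa pf pg|xa xf xg].
  by apply: (addL (Finite p)) pg; exact: (@local_ringM _ (Finite p)).
rewrite /twist_stalk /= mulrDr mulrCA; apply: (addL Infinity) xg.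
exact: (@local_ringM _ Infinity).
Qed.

Definition twist_pred U : {pred (U -> K)} := locally_fraction_pred twist_stalk U.
Arguments twist_pred : clear implicits.

Lemma twist_stalk0 x : twist_stalk x 0.
Proof.
by case: x => [|p|] //=; rewrite ?mulr0 -?tofrac0 -?polyC0;
  [exact: (local_ringC (Finite p)) | exact: (local_ringC Infinity)].
Qed.

Lemma twist_scale U (a : structure_sheaf U) (s t : U -> K) :
  s \in twist_pred U -> t \in twist_pred U -> val a * s + t \in twist_pred U.
Proof.
move=> /asboolP sU /asboolP tU; apply/asboolP.
have aU : locally_fraction (@local_ring k) (val a) by exact/asboolP/(valP a).
have asU : locally_fraction twist_stalk (fun x => val a x * s x).
  apply: (locally_fraction_comp (op := *%R)) aU sU => x f g xf xg.
  rewrite -[_ * _]addr0; exact: twist_stalk_muladd xf xg (twist_stalk0 x).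
apply: (locally_fraction_comp (op := +%R)) asU tU => x f g xf xg.
by rewrite -[f]mul1r; apply: twist_stalk_muladd => //; exact: local_ring1.
Qed.

Lemma twist_zmod U : zmod_closed (twist_pred U).
Proof.
have tw0 : (0 : U -> K) \in twist_pred U.
  apply/asboolP; apply: locally_fraction_cst (oset_open U) _ => x.
  exact: twist_stalk0.
split=> // s t sU tU.
have := twist_scale (-1) tU sU.
by rewrite rmorphN rmorph1 mulN1r addrC.
Qed.

HB.instance Definition _ U :=
  GRing.isZmodClosed.Build (U -> K) (twist_pred U) (twist_zmod U).

Definition twist_sec U := {s : U -> K | s \in twist_pred U}.
HB.instance Definition _ U := Choice.on (twist_sec U).
HB.instance Definition _ U : SubType _ _ (twist_sec U) :=
  SubType.on (twist_sec U).
HB.instance Definition _ U := [SubChoice_isSubZmodule of twist_sec U by <:].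

Lemma twist_mul_subproof U (a : structure_sheaf U) (s : twist_sec U) :
  val a * val s \in twist_pred U.
Proof.
by rewrite -[_ * _]addr0; apply: twist_scale; [exact: valP | exact: rpred0].
Qed.

Definition twist_mul U (a : structure_sheaf U) (s : twist_sec U) : twist_sec U :=
  exist _ (val a * val s) (twist_mul_subproof a s).

Lemma twist_mulA U a b (s : twist_sec U) :
  twist_mul a (twist_mul b s) = twist_mul (a * b) s.
Proof. by apply: val_inj; exact: mulrA. Qed.
Lemma twist_mul1 U : left_id 1 (@twist_mul U).
Proof. by move=> s; apply: val_inj; exact: mul1r. Qed.
Lemma twist_mulDr U : right_distributive (@twist_mul U) +%R.
Proof. by move=> a s t; apply: val_inj; exact: mulrDr. Qed.
Lemma twist_mulDl U s : {morph (@twist_mul U)^~ s : a b / a + b}.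
Proof. by move=> a b; apply: val_inj; exact: mulrDl. Qed.

HB.instance Definition _ U := GRing.Zmodule_isLmodule.Build (structure_sheaf U)
  (twist_sec U) (@twist_mulA U) (@twist_mul1 U) (@twist_mulDr U) (@twist_mulDl U).

Lemma twist_res_subproof U V (h : V `<=` U) (s : twist_sec U) :
  (val s \o incl h) \in twist_pred V.
Proof.
apply/asboolP/locally_fraction_res; first exact: oset_open.
exact/asboolP/(valP s).
Qed.

Definition twist_res U V (h : V `<=` U) (s : twist_sec U) : twist_sec V :=
  exist _ (val s \o incl h) (twist_res_subproof h s).

Lemma twist_res_linear U V (h : V `<=` U) (a : structure_sheaf U)
    (s t : twist_sec U) :
  twist_res h (a *: s + t) = res_fun h a *: twist_res h s + twist_res h t.
Proof. exact: val_inj. Qed.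

Lemma twist_res_id U (h : U `<=` U) (s : twist_sec U) : twist_res h s = s.
Proof.
apply: val_inj; apply/funext => x /=; congr (val s _); exact: val_inj.
Qed.

Lemma twist_res_comp U V W (h : V `<=` U) (h' : W `<=` V) (h'' : W `<=` U)
    (s : twist_sec U) : twist_res h' (twist_res h s) = twist_res h'' s.
Proof.
apply: val_inj; apply/funext => x /=; congr (val s _); exact: val_inj.
Qed.

Lemma twist_separated U (I : Type) (V : I -> opens (P1 k))
    (h : forall i, V i `<=` U) : U `<=` \bigcup_i V i ->
  forall s t : twist_sec U,
    (forall i, twist_res (h i) s = twist_res (h i) t) -> s = t.
Proof.
move=> UV s t st; apply: val_inj; apply/funext => x.
have [i _ Vx] := UV _ (set_mem (valP x)).
have := congr1 (fun u => val u (exist _ (val x) (mem_set Vx))) (st i).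
rewrite /=; have -> // : incl (h i) (exist _ (val x) (mem_set Vx)) = x.
exact: val_inj.
Qed.

Lemma twist_glue U (I : Type) (V : I -> opens (P1 k))
    (h : forall i, V i `<=` U) : U `<=` \bigcup_i V i ->
  forall s : (forall i, twist_sec (V i)),
    (forall i j W (hi : W `<=` V i) (hj : W `<=` V j),
       twist_res hi (s i) = twist_res hj (s j)) ->
  exists t : twist_sec U, forall i, twist_res (h i) t = s i.
Proof.
move=> UV s sE.
have cov (x : U) : exists i, oset (V i) (val x).
  by have [i _ Vx] := UV _ (set_mem (valP x)); exists i.
pose ix (x : U) := projT1 (cid (cov x)).
have ixP (x : U) : oset (V (ix x)) (val x) by exact: projT2 (cid (cov x)).
pose t (x : U) : K := val (s (ix x)) (exist _ (val x) (mem_set (ixP x))).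
have tE i (y : V i) : t (incl (h i) y) = val (s i) y.
  have oW : open (V (ix (incl (h i) y)) `&` V i) by apply: openI; exact: oset_open.
  pose W := Opens oW.
  have hi : W `<=` V (ix (incl (h i) y)) by move=> z [].
  have hj : W `<=` V i by move=> z [].
  have Wy : val y \in (W : set _).
    by apply/mem_set; split; [exact: (ixP (incl (h i) y)) | exact/set_mem/(valP y)].
  have := congr1 (fun u => val u (exist _ (val y) Wy)) (sE _ _ W hi hj).
  have ey : incl hj (exist _ (val y) Wy) = y by exact: val_inj.
  rewrite /= ey => <-; rewrite /t; congr (val (s _) _); exact: val_inj.
have tU : t \in twist_pred U.
  apply/asboolP/locally_fraction_local => x.
  exists (V (ix x)), (h (ix x)); split; [exact: oset_open | exact: ixP |].
  have -> : t \o incl (h (ix x)) = val (s (ix x)) by apply/funext => y /=.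
  exact/asboolP/(valP (s (ix x))).
exists (exist _ t tU) => i; apply: val_inj; apply/funext => y /=; exact: tE.
Qed.

Definition O_twist : omodule k :=
  OModule twist_res_linear twist_res_id twist_res_comp twist_separated twist_glue.

End Twist.

Section DirectSum.
Variables (R : pzRingType) (n : nat) (M : 'I_n -> lmodType R).

Definition dsum := forall i, M i.
HB.instance Definition _ := gen_eqMixin dsum.
HB.instance Definition _ := gen_choiceMixin dsum.

Definition dsum_zero : dsum := fun i => 0.
Definition dsum_add (s t : dsum) : dsum := fun i => s i + t i.
Definition dsum_opp (s : dsum) : dsum := fun i => - s i.
Definition dsum_scale (a : R) (s : dsum) : dsum := fun i => a *: s i.

Lemma dsum_addA : associative dsum_add.
Proof. by move=> s t u; apply: functional_extensionality_dep => i; exact: addrA. Qed.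
Lemma dsum_addC : commutative dsum_add.
Proof. by move=> s t; apply: functional_extensionality_dep => i; exact: addrC. Qed.
Lemma dsum_add0 : left_id dsum_zero dsum_add.
Proof. by move=> s; apply: functional_extensionality_dep => i; exact: add0r. Qed.
Lemma dsum_addN : left_inverse dsum_zero dsum_opp dsum_add.
Proof. by move=> s; apply: functional_extensionality_dep => i; exact: addNr. Qed.

HB.instance Definition _ :=
  GRing.isZmodule.Build dsum dsum_addA dsum_addC dsum_add0 dsum_addN.

Lemma dsum_scaleA a b s : dsum_scale a (dsum_scale b s) = dsum_scale (a * b) s.
Proof. by apply: functional_extensionality_dep => i; exact: scalerA. Qed.
Lemma dsum_scale1 : left_id 1 dsum_scale.
Proof. by move=> s; apply: functional_extensionality_dep => i; exact: scale1r. Qed.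
Lemma dsum_scaleDr : right_distributive dsum_scale +%R.
Proof. by move=> a s t; apply: functional_extensionality_dep => i; exact: scalerDr. Qed.
Lemma dsum_scaleDl s : {morph dsum_scale^~ s : a b / a + b}.
Proof. by move=> a b; apply: functional_extensionality_dep => i; exact: scalerDl. Qed.

HB.instance Definition _ := GRing.Zmodule_isLmodule.Build R dsum
  dsum_scaleA dsum_scale1 dsum_scaleDr dsum_scaleDl.

End DirectSum.

Section SheafSum.
Variables (k : fieldType) (n : nat) (E : 'I_n -> omodule k).
Implicit Types U V W : opens (P1 k).

Definition sum_sec U : lmodType (structure_sheaf U) := dsum (fun i => E i U).

Definition sum_res U V (h : V `<=` U) (s : sum_sec U) : sum_sec V :=
  fun i => res h (s i).

Lemma sum_res_linear U V (h : V `<=` U) (a : structure_sheaf U)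
    (s t : sum_sec U) :
  sum_res h (a *: s + t) = res_fun h a *: sum_res h s + sum_res h t.
Proof. by apply: functional_extensionality_dep => i; exact: res_linear. Qed.

Lemma sum_res_id U (h : U `<=` U) (s : sum_sec U) : sum_res h s = s.
Proof. by apply: functional_extensionality_dep => i; exact: res_id. Qed.

Lemma sum_res_comp U V W (h : V `<=` U) (h' : W `<=` V) (h'' : W `<=` U)
    (s : sum_sec U) : sum_res h' (sum_res h s) = sum_res h'' s.
Proof. by apply: functional_extensionality_dep => i; exact: res_comp. Qed.

Lemma sum_separated U (I : Type) (V : I -> opens (P1 k))
    (h : forall i, V i `<=` U) : U `<=` \bigcup_i V i ->
  forall s t : sum_sec U,
    (forall i, sum_res (h i) s = sum_res (h i) t) -> s = t.
Proof.
move=> UV s t st; apply: functional_extensionality_dep => i.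
by apply: (sheaf_separated UV) => j; exact: (congr1 (fun u : sum_sec _ => u i) (st j)).
Qed.

Lemma sum_glue U (I : Type) (V : I -> opens (P1 k))
    (h : forall i, V i `<=` U) : U `<=` \bigcup_i V i ->
  forall s : (forall i, sum_sec (V i)),
    (forall i j W (hi : W `<=` V i) (hj : W `<=` V j),
       sum_res hi (s i) = sum_res hj (s j)) ->
  exists t : sum_sec U, forall i, sum_res (h i) t = s i.
Proof.
move=> UV s sE.
have tP l : exists t : E l U, forall i, res (h i) t = s i l.
  apply: sheaf_glue UV (fun i => s i l) _ => i j W hi hj.
  exact: (congr1 (fun u : sum_sec _ => u l) (sE i j W hi hj)).
exists (fun l => projT1 (cid (tP l))) => i.
by apply: functional_extensionality_dep => l; exact: (projT2 (cid (tP l))).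
Qed.

Definition O_sum : omodule k :=
  OModule sum_res_linear sum_res_id sum_res_comp sum_separated sum_glue.

End SheafSum.

Section Skyscraper.
Variables (k : fieldType) (x : P1 k).
Implicit Types U V W : opens (P1 k).

(* There is no proof of x \in U, hence only the zero section, if x is not in U. *)
Definition sky_sec U := x \in (U : set _) -> residue_field x.
HB.instance Definition _ U := GRing.Zmodule.on (sky_sec U).

Definition sky_scale U (a : structure_sheaf U) (s : sky_sec U) : sky_sec U :=
  fun Ux => residue (germ Ux a) * s Ux.

Lemma sky_scaleA U a b (s : sky_sec U) :
  sky_scale a (sky_scale b s) = sky_scale (a * b) s.
Proof.
apply/funext => Ux; rewrite /sky_scale mulrA -residueM.
by congr (residue _ * _); exact: val_inj.
Qed.

Lemma sky_scale1 U : left_id 1 (@sky_scale U).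
Proof.
move=> s; apply/funext => Ux; rewrite /sky_scale.
have -> : germ Ux (1 : structure_sheaf U) = 1 by exact: val_inj.
by rewrite residue1 mul1r.
Qed.

Lemma sky_scaleDr U : right_distributive (@sky_scale U) +%R.
Proof. by move=> a s t; apply/funext => Ux; exact: mulrDr. Qed.

Lemma sky_scaleDl U s : {morph (@sky_scale U)^~ s : a b / a + b}.
Proof.
move=> a b; apply/funext => Ux; rewrite /sky_scale.
have -> : germ Ux (a + b) = germ Ux a + germ Ux b.
  by exact: val_inj.
by rewrite residueD mulrDl.
Qed.

HB.instance Definition _ U := GRing.Zmodule_isLmodule.Build (structure_sheaf U)
  (sky_sec U) (@sky_scaleA U) (@sky_scale1 U) (@sky_scaleDr U) (@sky_scaleDl U).

Definition sky_res U V (h : V `<=` U) (s : sky_sec U) : sky_sec V :=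
  fun Vx => s (mem_set (h _ (set_mem Vx))).

Lemma sky_res_linear U V (h : V `<=` U) (a : structure_sheaf U)
    (s t : sky_sec U) :
  sky_res h (a *: s + t) = res_fun h a *: sky_res h s + sky_res h t.
Proof.
apply/funext => Vx; congr (residue _ * _ + _); apply: val_inj => /=.
by congr (val a _); exact: val_inj.
Qed.

Lemma sky_res_id U (h : U `<=` U) (s : sky_sec U) : sky_res h s = s.
Proof. by apply/funext => Ux; congr (s _); exact: bool_irrelevance. Qed.

Lemma sky_res_comp U V W (h : V `<=` U) (h' : W `<=` V) (h'' : W `<=` U)
    (s : sky_sec U) : sky_res h' (sky_res h s) = sky_res h'' s.
Proof. by apply/funext => Ux; congr (s _); exact: bool_irrelevance. Qed.

Lemma sky_separated U (I : Type) (V : I -> opens (P1 k))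
    (h : forall i, V i `<=` U) : U `<=` \bigcup_i V i ->
  forall s t : sky_sec U,
    (forall i, sky_res (h i) s = sky_res (h i) t) -> s = t.
Proof.
move=> UV s t st; apply/funext => Ux.
have [i _ Vx] := UV _ (set_mem Ux).
have := congr1 (fun u : sky_sec _ => u (mem_set Vx)) (st i); rewrite /sky_res.
by rewrite (bool_irrelevance Ux (mem_set (h i x (set_mem (mem_set Vx))))).
Qed.

Lemma sky_glue U (I : Type) (V : I -> opens (P1 k))
    (h : forall i, V i `<=` U) : U `<=` \bigcup_i V i ->
  forall s : (forall i, sky_sec (V i)),
    (forall i j W (hi : W `<=` V i) (hj : W `<=` V j),
       sky_res hi (s i) = sky_res hj (s j)) ->
  exists t : sky_sec U, forall i, sky_res (h i) t = s i.
Proof.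
move=> UV s sE.
have cov (Ux : x \in (U : set _)) : exists i, x \in (V i : set _).
  by have [i _ Vx] := UV _ (set_mem Ux); exists i; exact: mem_set.
exists (fun Ux => s _ (projT2 (cid (cov Ux)))) => i.
apply/funext => Vx; rewrite /sky_res.
case: (cid _) => j Vjx /=.
have oW : open (V j `&` V i) by apply: openI; exact: oset_open.
pose W := Opens oW.
have hj : W `<=` V j by move=> z [].
have hi : W `<=` V i by move=> z [].
have Wx : x \in (W : set _) by apply/mem_set; split; exact/set_mem.
have := congr1 (fun u : sky_sec _ => u Wx) (sE _ _ W hj hi); rewrite /sky_res.
move=> e; apply: etrans (etrans e _); congr (s _ _); exact: bool_irrelevance.
Qed.

Definition skyscraper : omodule k :=
  OModule sky_res_linear sky_res_id sky_res_comp sky_separated sky_glue.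

End Skyscraper.

Definition hecke_modification_weight1 (k : fieldType) (x : P1 k) (E' E : omodule k) :
    Prop :=
  exists (phi : ohom E' E) (psi : ohom E (skyscraper x)), short_exact phi psi.

(* Main.v *)
(* A morphism from the sum of the O(d'_l) to the sum of the O(d_i) is a matrix P of
   polynomials with deg P_il <= d_i - d'_l.  If it is a Hecke modification at a finite
   place p, then p divides det P != 0.  If moreover d'_(j+1) > d_j, then P is block lower
   triangular and p divides the determinant of one of the two diagonal blocks; the degree
   of this determinant is at most the partial sum of the eps_i over the block, which is
   less than d = deg p when j is in [s, B[.

   Conversely, let e_l be the sum of the eps_i with i < l.  The interlacing inequalities
   allow the matrix with diagonal entries X^(eps_i) and entries -1 just above the diagonal
   in the rows s <= i < B, and with the digits of p in the mixed radix X^(eps_s), ...,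
   X^(eps_B) as row B.  Its determinant is p up to sign, and its image is the kernel of
   the reduction modulo p of the row of Horner quotients p div X^(e_(j+1)).

   At infinity d = 1, so a single eps_i is nonzero: the condition is empty, and the
   inclusion of O(d_s - 1) in O(d_s) gives the modification. *)

From HB Require Import structures.
From mathcomp Require Import all_boot all_order all_algebra perm.
From mathcomp Require Import boolp classical_sets functions cardinality topology.
From mathcomp Require Import zify ring.
Require Import Defs.

Set Implicit Arguments.
Unset Strict Implicit.
Unset Printing Implicit Defensive.

Import Order.TTheory GRing.Theory Num.Theory.
Local Open Scope ring_scope.

(** * Fractions of polynomials and the local rings at finite places and at infinity *)

Section Fractions.
Variable k : fieldType.
Local Notation K := (funfield k).
Implicit Types (a b c : {poly k}) (f g : K) (m : int).

Lemma fraction_tofrac f : exists a b, b != 0 /\ f = a%:F / b%:F.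
Proof.
elim/quotW: f => r; have r0 := denom_ratioP r.
exists (frac r).1, (frac r).2; split=> //.
apply: (canRL (mulfK _)); first by rewrite tofrac_neq0.
unlock FracField.tofrac; rewrite -[LHS]FracField.pi_mul.
apply/eqmodP; rewrite /= FracField.equivfE /FracField.mulf.
by rewrite !numden_Ratio ?(oner_neq0, mulr1, mulf_neq0) // mulrC.
Qed.

Lemma frac_eq a b c d : b != 0 -> d != 0 ->
  (a%:F / b%:F == c%:F / d%:F :> K) = (a * d == c * b).
Proof.
by move=> b0 d0; rewrite eqr_div ?tofrac_neq0 // -!tofracM tofrac_eq.
Qed.

Lemma tofracX_neq0 : 'X%:F != 0 :> K.
Proof. by rewrite tofrac_neq0 polyX_eq0. Qed.

Lemma local_infinity_frac a b : a != 0 -> b != 0 ->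
  local_ring Infinity (a%:F / b%:F) <-> (size a <= size b)%N.
Proof.
move=> a0 b0; split=> [[c [d [d0 cd /eqP]]]|ab]; last by exists a, b.
rewrite frac_eq // => /eqP adcb.
have c0 : c != 0.
  by apply: contraNneq (mulf_neq0 a0 d0) => c0; rewrite adcb c0 mul0r.
have := congr1 (fun q : {poly k} => size q) adcb; rewrite !size_mul //.
move: a0 b0 c0 d0 cd; rewrite -!size_poly_gt0; move: (size a) (size b) (size c) (size d); lia.
Qed.

(** The order of X^m a / b at infinity is deg b - deg a - m; sizes in place of degrees shift both
    sides by one. *)
Lemma local_infinityXP m a b : a != 0 -> b != 0 ->
  local_ring Infinity ('X%:F ^ m * (a%:F / b%:F)) <->
  m + (size a)%:Z <= (size b)%:Z.
Proof.
move=> a0 b0; have Xn n : 'X^n != 0 :> {poly k} by rewrite monic_neq0 ?monicXn.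
case: m => n.
  rewrite -exprnP -tofracXn mulrA -tofracM.
  rewrite local_infinity_frac ?mulf_neq0 // size_mul // size_polyXn.
  move: a0 b0; rewrite -!size_poly_gt0; move: (size a) (size b); lia.
rewrite NegzE -exprnN -exprVn exprVn -tofracXn mulrC -mulrA -invfM -tofracM.
rewrite local_infinity_frac ?mulf_neq0 // size_mul // size_polyXn.
move: a0 b0; rewrite -!size_poly_gt0; move: (size a) (size b); lia.
Qed.

Lemma local_finite_poly (p : monic_irreducible k) a : local_ring (Finite p) a%:F.
Proof.
exists a, 1; rewrite tofrac1 divr1; split=> //.
by rewrite dvdp1; have [] := mi_irr p; case: ltngtP.
Qed.

(** Strong induction on the size: a nonconstant divisor not associate to b is smaller, and if there
    is none, b divided by its leading coefficient is the prime. *)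
Lemma exists_monic_irreducible b : (1 < size b)%N ->
  exists p : monic_irreducible k, (p %| b)%R.
Proof.
elim: {b}(size b) {-2}b (leqnn (size b)) => [b|n IHn b] szb b1.
  by move: szb b1; case: (size b).
have [[q [q1 qb sq]]|irr] :=
    pselect (exists q : {poly k}, [/\ size q != 1%N, (q %| b)%R & ~~ (q %= b)]).
  have b0 : b != 0 by rewrite -size_poly_gt0 (ltn_trans _ b1).
  have q0 : q != 0 by apply: contraNneq b0 => q0; rewrite q0 dvd0p in qb.
  have sqb : (size q < size b)%N.
    by rewrite ltn_neqAle dvdp_leq // andbT -(dvdp_size_eqp qb) in sq *.
  have [||p pq] := IHn q; first by rewrite -ltnS (leq_trans sqb).
    by move: q0 q1; rewrite -size_poly_gt0; case: (size q) => [|[]].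
  by exists p; exact: dvdp_trans pq qb.
have b0 : b != 0 by rewrite -size_poly_gt0 (ltn_trans _ b1).
have l0 : (lead_coef b)^-1 != 0 by rewrite invr_eq0 lead_coef_eq0.
have pm : (lead_coef b)^-1 *: b \is monic.
  by rewrite monicE lead_coefZ mulVf // lead_coef_eq0.
have pi : irreducible_poly ((lead_coef b)^-1 *: b).
  split; first by rewrite size_scale.
  move=> q q1; rewrite dvdpZr // => qb; rewrite eqp_sym (eqp_ltrans (eqp_scale _ l0)).
  by rewrite eqp_sym; apply: contra_notT irr => nq; exists q.
by exists (MonicIrreducible pm pi); rewrite /= dvdpZl.
Qed.

(* A prime dividing the denominator of a reduced fraction excludes it from one local ring. *)
Lemma poly_of_local_finite f : (forall p, local_ring (Finite p) f) ->
  exists a, f = a%:F.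
Proof.
have [a [b [b0 ->]]] := fraction_tofrac f => loc.
have g0 : gcdp a b != 0 by rewrite gcdp_eq0 negb_and b0 orbT.
pose a' := a %/ gcdp a b; pose b' := b %/ gcdp a b.
have aE : a = a' * gcdp a b by rewrite divpK ?dvdp_gcdl.
have bE : b = b' * gcdp a b by rewrite divpK ?dvdp_gcdr.
have cop : coprimep a' b' by apply: coprimep_div_gcd; rewrite b0 orbT.
have b'0 : b' != 0 by apply: contraNneq b0 => b'0; rewrite bE b'0 mul0r.
have fE : a%:F / b%:F = a'%:F / b'%:F :> K.
  apply/eqP; rewrite frac_eq //; apply/eqP; rewrite {1}aE {2}bE mulrAC -!mulrA.
  by congr (_ * _); rewrite mulrC.
have [b1|b1] := ltnP 1 (size b').
  have [p pb] := exists_monic_irreducible b1.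
  have [c [d [pd /eqP]]] := loc p.
  rewrite fE frac_eq ?(ndvd_neq0 pd) // => /eqP adcb.
  have : (p %| a' * d)%R by rewrite adcb dvdp_mull.
  rewrite Gauss_dvdpl ?irreducible_poly_coprime //; last exact: mi_irr.
  move=> pa; have := dvdp_gcd p a' b'; rewrite pa pb.
  rewrite (eqp_dvdr _ (_ : _ %= 1)) ?dvdp1; last by rewrite -size_poly_eq1 -coprimep_def.
  by have [] := mi_irr p; case: ltngtP.
have /size_poly1P [c c0 b'E] : size b' == 1%N by rewrite eqn_leq b1 size_poly_gt0.
exists (c^-1 *: a'); rewrite fE b'E; apply/eqP.
rewrite -[X in _ == X]divr1 -tofrac1 frac_eq ?oner_neq0 ?polyC_eq0 // mulr1.
by rewrite mulrC mul_polyC scalerA mulfV ?scale1r.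
Qed.

End Fractions.

(** * Stalks of O(m) and residue classes *)

Section Stalks.
Local Open Scope classical_set_scope.
Variable k : fieldType.
Local Notation K := (funfield k).
Implicit Types (y : P1 k) (f g : K) (m : int).

Lemma local_ringP y f : reflect (local_ring y f) (f \in local_ring_pred y).
Proof. exact: asboolP. Qed.

Lemma local_ring_sum y (I : Type) (r : seq I) (P : pred I) (F : I -> K) :
  (forall i, P i -> local_ring y (F i)) ->
  local_ring y (\sum_(i <- r | P i) F i).
Proof.
by move=> yF; apply/local_ringP/rpred_sum => i /yF yFi; exact/local_ringP.
Qed.

Lemma twist_stalk_sum m y (I : Type) (r : seq I) (P : pred I) (F : I -> K) :
  (forall i, P i -> twist_stalk m y (F i)) ->
  twist_stalk m y (\sum_(i <- r | P i) F i).
Proof.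
move=> yF; elim/big_ind: _ => //; first exact: twist_stalk0.
by move=> f g yf yg; rewrite -[f]mul1r; apply: twist_stalk_muladd => //; exact: local_ring1.
Qed.

Lemma twist_stalk_scale m y c f : local_ring y c ->
  twist_stalk m y f -> twist_stalk m y (c * f).
Proof.
by move=> yc yf; rewrite -[_ * _]addr0; apply: twist_stalk_muladd (twist_stalk0 _ _).
Qed.

Lemma twist_stalk_finite m y f : y <> Infinity ->
  twist_stalk m y f = local_ring y f.
Proof. by case: y. Qed.

Lemma twist_stalk_infinity m f :
  twist_stalk m Infinity f = local_ring Infinity ('X%:F ^ (- m) * f).
Proof. by []. Qed.

Lemma twist_infinity_mul m m' c f :
  local_ring Infinity ('X%:F ^ (m - m') * c) ->
  twist_stalk m Infinity f -> twist_stalk m' Infinity (c * f).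
Proof.
rewrite !twist_stalk_infinity => mc mf.
have -> : 'X%:F ^ (- m') * (c * f) = ('X%:F ^ (m - m') * c) * ('X%:F ^ (- m) * f).
  rewrite mulrACA -expfzDr ?tofracX_neq0 //.
  by rewrite addrAC subrr add0r.
exact: (@local_ringM _ Infinity).
Qed.

Lemma twist_infinity_poly m (a : {poly k}) : a != 0 ->
  twist_stalk m Infinity a%:F <-> (size a)%:Z <= m + 1.
Proof.
move=> a0; rewrite twist_stalk_infinity -[a%:F]divr1 -tofrac1 local_infinityXP ?oner_neq0 //.
by rewrite size_poly1 /=; split; lia.
Qed.

Lemma residue_eq0 y (u : stalkO y) : residue u = 0 <-> max_ideal y (val u).
Proof.
have -> : (0 : residue_field y) = residue (0 : stalkO y).
  by apply: (addrI (residue 0)); rewrite -residueD !addr0.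
rewrite /residue; split.
  by move/eqP; rewrite -Quotient.idealrBE subr0 => /asboolP.
by move=> mu; apply/eqP; rewrite -Quotient.idealrBE subr0; apply/asboolP.
Qed.

Lemma residueB y (u v : stalkO y) : residue u - residue v = residue (u - v).
Proof. by apply/eqP; rewrite subr_eq -residueD subrK. Qed.

Lemma residue_eq y (u v : stalkO y) :
  residue u = residue v <-> max_ideal y (val u - val v).
Proof.
rewrite -rmorphB -residue_eq0 -residueB.
by split=> /eqP; [rewrite -subr_eq0 => /eqP | rewrite subr_eq0 => /eqP].
Qed.

End Stalks.

(** * Open sets of the line, and sections of O(m) as single elements of K *)

Section Opens.
Local Open Scope classical_set_scope.
Variable k : fieldType.
Local Notation K := (funfield k).
Implicit Types (U V : set (P1 k)) (L : P1 k -> set K).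

Lemma open_generic U y : open U -> U y -> U Generic.
Proof. by move=> oU Uy; have [|//] := (oU : zariski_open U); exists y. Qed.

Lemma cofinite_open U : U Generic -> finite_set (~` U) -> open U.
Proof. by move=> UG fU; apply: (_ : zariski_open U). Qed.

(** Irreducibility of the line: nonempty opens all contain the generic point, so any two local
    fractions of a section agree there. *)
Lemma locally_fractionP L U (s : U -> K) : open U ->
  locally_fraction L s <->
  (forall y, L (val y) (s y)) /\ (forall y z, s y = s z).
Proof.
move=> oU; split=> [sL|[sL sE] x].
  split=> [y|y z]; first exact: (@locally_fraction_mem _ L).
  have [V [f [[oV Vy] VU Vf]]] := sL y; have [W [g [[oW Wz] WU Wg]]] := sL z.
  have VG := open_generic oV Vy; have WG := open_generic oW Wz.
  pose G : U := exist _ Generic (mem_set (VU _ VG)).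
  by rewrite (Vf y Vy).2 (Wg z Wz).2 -(Vf G VG).2 -(Wg G WG).2.
exists U, (s x); split=> //; first by split=> //; exact/set_mem/(valP x).
by move=> y _; rewrite (sE x y).
Qed.

Lemma monic_irreducible_inj : injective (@mi_poly k).
Proof.
move=> [p pm pi] [q qm qi] /= pq; subst q.
by congr MonicIrreducible; [exact: bool_irrelevance | exact: Prop_irrelevance].
Qed.

End Opens.

Section FiniteField.
Local Open Scope classical_set_scope.
Variable k : finFieldType.
Local Notation K := (funfield k).

(** Finiteness of k enters here: a divisor of b has size at most [size b], and there are finitely
    many such polynomials. *)
Lemma finite_prime_divisors (b : {poly k}) : b != 0 ->
  finite_set [set p : monic_irreducible k | (p %| b)%R].
Proof.
move=> b0; pose B : set {poly k} := range (@rVpoly k (size b)).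
apply: (@sub_finite_set _ _ (@mi_poly k @^-1` B)) => [p /= pb|].
  by exists (poly_rV p) => //; rewrite poly_rV_K // dvdp_leq.
apply: finite_preimage; first by move=> p q _ _; exact: monic_irreducible_inj.
exact/finite_image/finite_finset.
Qed.

(** The points left out are among infinity and the primes dividing a denominator of f. *)
Lemma stalk_open m (f : K) : open [set y | twist_stalk m y f].
Proof.
have [a [b [b0 ->]]] := fraction_tofrac f; apply: cofinite_open => //=.
pose D := [set Finite p | p in [set p : monic_irreducible k | (p %| b)%R]].
apply: (@sub_finite_set _ _ ([set Infinity] `|` D)); last first.
  rewrite finite_setU; split; first exact: finite_set1.
  exact/finite_image/finite_prime_divisors.
case=> [|p|] /=; [by case | move=> npf; right | by left].
by exists p => //=; apply: contra_notT npf => pb; exists a, b.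
Qed.

End FiniteField.

Section Sections.
Local Open Scope classical_set_scope.
Variable k : fieldType.
Local Notation K := (funfield k).
Implicit Types (U : opens (P1 k)) (m : int).

Lemma twist_secP m U (s : U -> K) : s \in @twist_pred k m U <->
  (forall y, twist_stalk m (val y) (s y)) /\ (forall y z, s y = s z).
Proof.
rewrite -(@locally_fractionP _ (twist_stalk m) U s (oset_open U)).
by split=> /asboolP.
Qed.

Lemma twist_sec_stalk m U (s : twist_sec m U) y : twist_stalk m (val y) (val s y).
Proof. by have /twist_secP[] := valP s. Qed.

Lemma twist_sec_const m U (s : twist_sec m U) y z : val s y = val s z.
Proof. by have /twist_secP[_] := valP s. Qed.

Lemma const_sec_subproof m U (f : K) :
  (forall y : P1 k, oset U y -> twist_stalk m y f) ->
  (fun _ : U => f) \in @twist_pred k m U.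
Proof. by move=> Uf; apply/twist_secP; split=> // y; apply/Uf/set_mem/(valP y). Qed.

Definition const_sec m U (f : K) (Uf : forall y, oset U y -> twist_stalk m y f) :
  twist_sec m U := exist (fun s => s \in @twist_pred k m U) _ (const_sec_subproof Uf).

End Sections.

(** * A Hecke modification from a matrix P and a row r over K *)

Section HeckeOfMatrix.
Local Open Scope classical_set_scope.
Variables (k : finFieldType) (x : P1 k) (n : nat) (dE dE' : 'I_n -> int).
Local Notation K := (funfield k).
Variables (P : 'M[K]_n) (r : 'I_n -> K).
Local Notation E := (O_sum (fun i => O_twist k (dE i))).
Local Notation E' := (O_sum (fun i => O_twist k (dE' i))).

Hypothesis x_closed : closed [set x].
(** Exactness of 0 -> E' -> E -> kappa(x) -> 0 in terms of elements of K, which suffice because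
    sections are constant functions. The two stalk conditions define the maps, [rP_max] makes the
    composite zero, [r_onto] gives surjectivity, and [P_onto] gives injectivity and exactness in the
    middle. *)
Hypothesis P_stalk : forall y i l f,
  twist_stalk (dE' l) y f -> twist_stalk (dE i) y (P i l * f).
Hypothesis r_stalk : forall i f,
  twist_stalk (dE i) x f -> local_ring x (r i * f).
Hypothesis rP_max : forall w : 'I_n -> K,
  (forall l, twist_stalk (dE' l) x (w l)) ->
  max_ideal x (\sum_i r i * \sum_l P i l * w l).
Hypothesis r_onto : exists i f, twist_stalk (dE i) x f /\ r i * f = 1.
Hypothesis P_onto : forall v : 'I_n -> K, exists w : 'I_n -> K,
  (forall i, \sum_l P i l * w l = v i) /\
  forall y, (forall i, twist_stalk (dE i) y (v i)) ->
    (y = x -> max_ideal x (\sum_i r i * v i)) ->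
    forall l, twist_stalk (dE' l) y (w l).

Lemma phi_subproof (U : opens (P1 k)) (s : E' U) i :
  (fun y : U => \sum_l P i l * val (s l) y) \in @twist_pred k (dE i) U.
Proof.
apply/twist_secP; split=> [y|y z].
  by apply: twist_stalk_sum => l _; apply/P_stalk/twist_sec_stalk.
by apply: eq_bigr => l _; rewrite (twist_sec_const (s l) y z).
Qed.

Definition phi_fun (U : opens (P1 k)) (s : E' U) : E U :=
  fun i => exist (fun t => t \in @twist_pred k (dE i) U) _ (phi_subproof s i).

Lemma phi_linear U : linear (@phi_fun U).
Proof.
move=> a s t; apply: functional_extensionality_dep => i.
apply: val_inj; apply/funext => y.
transitivity (val a y * (\sum_l P i l * val (s l) y) + \sum_l P i l * val (t l) y) => //.
rewrite mulr_sumr -big_split; apply: eq_bigr => l _.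
transitivity (P i l * (val a y * val (s l) y + val (t l) y)) => //.
by rewrite mulrDr mulrCA.
Qed.

HB.instance Definition _ U := GRing.isLinear.Build
  (structure_sheaf U) (E' U) (E U) _ (@phi_fun U) (@phi_linear U).

Lemma phi_res (U V : opens (P1 k)) (h : V `<=` U) (s : E' U) :
  phi_fun (res h s) = res h (phi_fun s).
Proof.
by apply: functional_extensionality_dep => i; apply: val_inj; apply/funext.
Qed.

Definition phi_hom : ohom E' E := OHom phi_res.

Lemma psi_subproof (U : opens (P1 k)) (s : E U) (Ux : x \in (U : set _)) :
  \sum_i r i * val (s i) (exist _ x Ux) \in local_ring_pred x.
Proof.
apply/local_ringP/local_ring_sum => i _.
by apply: r_stalk; exact: (twist_sec_stalk (s i) (exist _ x Ux)).
Qed.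

Definition psi_fun (U : opens (P1 k)) (s : E U) : skyscraper x U :=
  fun Ux => residue (exist (fun f => f \in local_ring_pred x) _ (psi_subproof s Ux) : stalkO x).

Lemma psi_linear U : linear (@psi_fun U).
Proof.
move=> a s t; apply/funext => Ux.
transitivity (residue (germ Ux a) * psi_fun s Ux + psi_fun t Ux) => //.
rewrite /psi_fun -residueM -residueD; congr residue; apply: val_inj => /=.
rewrite mulr_sumr -big_split; apply: eq_bigr => i _.
set xU := exist _ x Ux.
transitivity (r i * (val a xU * val (s i) xU + val (t i) xU)) => //.
by rewrite mulrDr mulrCA.
Qed.

HB.instance Definition _ U := GRing.isLinear.Build
  (structure_sheaf U) (E U) (skyscraper x U) _ (@psi_fun U) (@psi_linear U).

Lemma psi_res (U V : opens (P1 k)) (h : V `<=` U) (s : E U) :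
  psi_fun (res h s) = res h (psi_fun s).
Proof.
apply/funext => Vx; congr residue; apply: val_inj => /=.
apply: eq_bigr => i _; congr (_ * val (s i) _); exact: val_inj.
Qed.

Definition psi_hom : ohom E (skyscraper x) := OHom psi_res.

(** Preimages of the unit vectors form a right inverse of P, which for a square matrix is also a
    left inverse. *)
Lemma mx_inj_of_onto (w : 'I_n -> K) : (forall i, \sum_l P i l * w l = 0) -> w =1 cst 0.
Proof.
have [W WE] := choice (fun j => P_onto (fun i => (i == j)%:R)).
have PW : P *m (\matrix_(l, j) W j l) = 1%:M.
  apply/matrixP => i j; rewrite !mxE -(WE j).1.
  by apply: eq_bigr => l _; rewrite mxE.
move=> Pw l; pose c := \col_l w l.
have Pc : P *m c = 0.
  by apply/matrixP => i j; rewrite !mxE -[RHS](Pw i); apply: eq_bigr => m _; rewrite mxE.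
have := congr1 (mulmx (\matrix_(l, j) W j l)) Pc.
rewrite mulmxA (mulmx1C PW) mul1mx mulmx0 => /matrixP/(_ l 0).
by rewrite !mxE.
Qed.

Lemma phi_inj (U : opens (P1 k)) (s : E' U) : phi_hom U s = 0 -> s = 0.
Proof.
move=> s0; apply: functional_extensionality_dep => l.
apply: val_inj; apply/funext => y; apply: (mx_inj_of_onto (w := fun l => val (s l) y)) => i.
exact: (congr1 (fun t : E U => val (t i) y) s0).
Qed.

Lemma psi_eq0 (U : opens (P1 k)) (s : E U) : psi_hom U s = 0 <->
  forall Ux : x \in (U : set _), max_ideal x (\sum_i r i * val (s i) (exist _ x Ux)).
Proof.
split=> [s0 Ux|s0]; first exact: (residue_eq0 _).1 (congr1 (@^~ Ux) s0).
by apply/funext => Ux; change (psi_fun s Ux = 0); apply/residue_eq0/s0.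
Qed.

Lemma psi_ker (U : opens (P1 k)) (s : E U) :
  psi_hom U s = 0 <-> in_image phi_hom s.
Proof.
rewrite psi_eq0; split=> [s0 y Uy|sP Ux]; last first.
  have [V [h [t [Vx /= tE]]]] := sP x (set_mem Ux).
  pose xV : V := exist _ x (mem_set Vx).
  have sE i : val (s i) (exist _ x Ux) = \sum_l P i l * val (t l) xV.
    apply: esym; apply: etrans (congr1 (fun t : E V => val (t i) xV) tE) _.
    by congr (val (s i) _); exact: val_inj.
  under eq_bigr do rewrite sE.
  by apply: rP_max => l; exact: (twist_sec_stalk (t l) xV).
(* As s is constant on U, the solution w found at the single point y is a preimage over all of U. *)
pose yU : U := exist _ y (mem_set Uy).
have [w [Pw wE]] := P_onto (fun i => val (s i) yU).
have wU l z : oset U z -> twist_stalk (dE' l) z (w l).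
  move=> Uz; pose zU : U := exist _ z (mem_set Uz); apply: wE => [i|zx].
    by rewrite (twist_sec_const _ _ zU); exact: (twist_sec_stalk _ zU).
  subst z; under eq_bigr do rewrite (twist_sec_const _ _ zU).
  exact: s0.
exists U, (fun z Uz => Uz), (fun l => const_sec (wU l)); split=> //.
apply: functional_extensionality_dep => i; apply: val_inj; apply/funext => z.
apply: etrans (Pw i) _; exact: twist_sec_const.
Qed.

Lemma psi_onto (U : opens (P1 k)) (t : skyscraper x U) : in_image psi_hom t.
Proof.
(* Away from x, the closed point x can be removed from U; only the zero section of the skyscraper is
   left. *)
move=> y Uy; have [yx|yx] := pselect (y = x); last first.
  have oV : open ((U : set _) `&` ~` [set x]).
    by apply: openI; [exact: oset_open | rewrite openC].
  exists (Opens oV), (fun z => @proj1 _ _), 0; split=> //.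
  by apply/funext => Vx; case: (set_mem Vx) => _ /(_ erefl).
subst y; have [i0 [f [fx rf]]] := r_onto; pose Ux := mem_set Uy.
have [g gE] : exists g : stalkO x, residue g = t Ux.
  by exists (repr (t Ux)); exact: reprK.
(* Near x the section with g f in coordinate [i0] and 0 elsewhere is defined, and r sends it to
   g. *)
have oV : open ((U : set _) `&` [set z | twist_stalk (dE i0) z (val g * f)]).
  by apply: openI; [exact: oset_open | exact: stalk_open].
pose V := Opens oV; have VU : V `<=` U by move=> z [].
have sV i z : oset V z ->
    twist_stalk (dE i) z (if i == i0 then val g * f else 0).
  by case: eqP => [->|_] [_ Vz] //; exact: twist_stalk0.
pose s : E V := fun i => const_sec (sV i).
exists V, VU, s; split.
  split=> //; apply: twist_stalk_scale fx; exact/local_ringP/(valP g).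
apply/funext => Vx; rewrite /= /sky_res /psi_fun.
have -> : t (mem_set (VU x (set_mem Vx))) = t Ux.
  by congr (t _); exact: bool_irrelevance.
rewrite -gE; congr residue; apply: val_inj => /=.
rewrite (bigD1 i0) //= eqxx mulrCA rf mulr1 big1 ?addr0 // => i /negPf ->.
by rewrite mulr0.
Qed.

Theorem hecke_of_matrix : hecke_modification_weight1 x E' E.
Proof.
exists phi_hom, psi_hom; split; [exact: phi_inj | exact: psi_ker | exact: psi_onto].
Qed.

End HeckeOfMatrix.

(** * Degrees of the closed points *)

Section Degree.
Local Open Scope classical_set_scope.
Variable k : finFieldType.
Local Notation K := (funfield k).
Implicit Types (p : monic_irreducible k) (a b : {poly k}) (f : K).

(** Counting over a finite field: h and the coordinate map yield injections both ways between the
    row spaces, so |k|^d = |k|^m. A mere bijection h suffices. *)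
Lemma has_degree_dim (x : P1 k) d m (h : 'rV[k]_m -> residue_field x) :
  injective h -> (forall z, exists c, h c = z) -> has_degree x d -> d = m.
Proof.
move=> hI /choice[g gK] [e eP].
have [f fP] := choice eP.
have fI : injective (f \o h).
  by move=> c c' /= fc; apply: hI; rewrite (fP (h c)).1 fc -(fP _).1.
pose G (c : 'rV[k]_d) := \sum_i residue (const_stalk x (c 0 i)) * e i.
have gI : injective (g \o G).
  move=> c c' /= /(congr1 h); rewrite !gK => Gc.
  by rewrite -((fP (G c)).2 c erefl) ((fP (G c)).2 c' Gc).
have := leq_card _ fI; have := leq_card _ gI.
rewrite !card_mx !mul1n !leq_exp2l ?card_finNzRing_gt1 // => dm md.
by apply/eqP; rewrite eqn_leq dm md.
Qed.

Lemma max_finiteP p f :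
  max_ideal (Finite p) f <-> local_ring (Finite p) (f / (p : {poly k})%:F).
Proof.
have p0 : (p : {poly k}) != 0 by exact: irredp_neq0 (mi_irr p).
split=> [[a [b [/dvdpP[c ->] pb ->]]]|[a [b [pb fE]]]].
  exists c, b; split=> //; rewrite mulrAC tofracM mulfK ?tofrac_neq0 //.
exists (a * p), b; split; rewrite ?dvdp_mull // tofracM mulrAC -fE.
by rewrite divfK ?tofrac_neq0.
Qed.

Lemma max_finite_poly p a : max_ideal (Finite p) a%:F <-> (p %| a)%R.
Proof.
rewrite -[a%:F]divr1 -tofrac1; split=> [[c [d [pc pd /eqP]]]|pa].
  rewrite frac_eq ?oner_neq0 ?(ndvd_neq0 pd) // mulr1 => /eqP adc.
  by rewrite -adc Gauss_dvdpl ?irreducible_poly_coprime // in pc; exact: mi_irr.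
exists a, 1; split=> //; rewrite dvdp1.
by have [] := mi_irr p; case: ltngtP.
Qed.

Definition poly_stalk p a : stalkO (Finite p) :=
  exist (fun f => f \in local_ring_pred (Finite p)) a%:F
    (introT (local_ringP _ _) (local_finite_poly p a)).

(** Polynomials of degree less than deg p represent each residue class exactly once. *)
Lemma degree_finite p d : has_degree (Finite p) d -> size p = d.+1.
Proof.
have sp : (1 < size p)%N by have [] := mi_irr p.
move=> /(@has_degree_dim _ _ (size p).-1 (fun c => residue (poly_stalk p (rVpoly c)))).
move=> -> //; first by move: sp; case: (size p).
  move=> c c' /residue_eq; rewrite /= -tofracB -raddfB => /max_finite_poly pc.
  apply/eqP; rewrite -subr_eq0; apply: contraT => cc0.
  have: rVpoly (c - c') != 0.
    by apply: contraNneq cc0 => c0; rewrite -(rVpolyK (c - c')) c0 linear0.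
  move=> /dvdp_leq/(_ pc) pleq; have : (size p <= (size p).-1)%N.
    by rewrite (leq_trans pleq) ?size_poly.
  by move: sp; case: (size p) => // m _; rewrite ltnn.
move=> z; have [a [b [pb uE]]] := set_mem (valP (repr z)).
have : coprimep p b by rewrite irreducible_poly_coprime //; exact: mi_irr.
move=> /Bezout_eq1_coprimepP[[u v] /= uv].
(* By the Bezout relation v inverts b modulo p, so a v represents the class of a / b. *)
exists (poly_rV ((a * v) %% p)).
rewrite -[RHS]reprK; apply/residue_eq; rewrite /= uE poly_rV_K; last first.
  have := ltn_modpN0 (a * v) (irredp_neq0 (mi_irr p)); move: sp.
  by case: (size p).
have b0 := ndvd_neq0 pb.
rewrite -[((a * v) %% p)%:F]divr1 -tofrac1 fracB ?oner_neq0 // mul1r mulr1.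
exists ((a * v) %% p * b - a), b; split=> //.
have -> : (a * v) %% p * b - a = - ((p : {poly k}) * ((a * v) %/ p * b + a * u)).
  rewrite -[a in _ - a]mulr1 -uv (canRL (addKr _) (esym (divp_eq (a * v) p))); ring.
by rewrite dvdpNr dvdp_mulr.
Qed.

Lemma degree_infinity d : has_degree (@Infinity k) d -> d = 1%N.
Proof.
move/(@has_degree_dim _ _ 1 (fun c : 'rV[k]_1 => residue (const_stalk _ (c 0 0)))).
apply=> [c c' /residue_eq /=|z].
  rewrite -tofracB -polyCB -[_%:F]divr1 -tofrac1 => -[a [b [b0 ab /eqP]]].
  rewrite frac_eq ?oner_neq0 // mulr1 => /eqP cE.
  apply/matrixP => i j; rewrite !ord1; apply/eqP; rewrite -subr_eq0.
  by apply: contraTT ab => c0; rewrite -cE mul_polyC size_scale // ltnn.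
have [a [b [b0 ab uE]]] := set_mem (valP (repr z)).
(* The value of a / b at infinity: the coefficient of a is taken at the degree of b, so that c b - a
   loses its top term. *)
pose c := a`_(size b).-1 / lead_coef b; exists (const_mx c).
rewrite -[RHS]reprK; apply/residue_eq; rewrite /= uE mxE.
rewrite -[c%:P%:F]divr1 -tofrac1 fracB ?oner_neq0 // mul1r mulr1.
exists (c%:P * b - a), b; split=> //.
have sb : (size b).-1.+1 = size b by rewrite prednK ?size_poly_gt0.
rewrite -[X in (_ < X)%N]sb ltnS; apply/leq_sizeP => j; rewrite leq_eqVlt.
rewrite coefB coefCM => /predU1P[<-|bj].
  by rewrite -/(lead_coef b) /c divfK ?subrr ?lead_coef_eq0.
by rewrite !nth_default ?mulr0 ?subrr // ?(leq_trans ab) // -sb.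
Qed.

End Degree.

(** * Degree bounds for determinants *)

Section DetDegree.
Local Open Scope classical_set_scope.
Variable k : fieldType.
Local Notation K := (funfield k).

Lemma twist_infinity_prod (I : Type) (r : seq I) (m : I -> int) (F : I -> K) :
  (forall i, twist_stalk (m i) Infinity (F i)) ->
  twist_stalk (\sum_(i <- r) m i) Infinity (\prod_(i <- r) F i).
Proof.
move=> mF; elim: r => [|i r IHr].
  by rewrite !big_nil twist_stalk_infinity oppr0 expr0z mul1r; exact: local_ring1.
rewrite !big_cons; apply: twist_infinity_mul IHr.
by rewrite opprD addrCA subrr addr0; exact: mF.
Qed.

(** In the Leibniz formula the permutation s contributes the bound sum of a_i - b_(s i), which is
    the same for all s. *)
Lemma det_degree n (Q : 'M[{poly k}]_n) (a b : 'I_n -> int) :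
  (forall i l, twist_stalk (a i - b l) Infinity (Q i l)%:F) ->
  twist_stalk (\sum_i (a i - b i)) Infinity (\det Q)%:F.
Proof.
move=> Qd; rewrite /determinant rmorph_sum; apply: twist_stalk_sum => s _.
rewrite rmorphM rmorphXn rmorphN1; apply: twist_stalk_scale.
  apply/local_ringP; rewrite rpredX // rpredN1 //.
rewrite rmorph_prod; have -> : \sum_i (a i - b i) = \sum_i (a i - b (s i)).
  rewrite !sumrB; congr (_ - _); exact: (reindex_inj (@perm_inj _ s)).
exact: twist_infinity_prod.
Qed.

(** The determinant is the product of those of the diagonal blocks, so the prime p divides one of
    them, and [det_degree] applies to that block. The + 1 turns degrees into sizes. *)
Lemma lower_block_degree n m1 m2 (Q : 'M[{poly k}]_n) (a b : 'I_n -> int)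
    (p : {poly k}) : n = (m1 + m2)%N -> irreducible_poly p ->
  (forall i l, twist_stalk (a i - b l) Infinity (Q i l)%:F) ->
  (forall i l : 'I_n, (i < m1 <= l)%N -> Q i l = 0) ->
  \det Q != 0 -> (p %| \det Q)%R ->
  (size p)%:Z <= \sum_(i < n | (i < m1)%N) (a i - b i) + 1 \/
  (size p)%:Z <= \sum_(i < n | (m1 <= i)%N) (a i - b i) + 1.
Proof.
move=> En; subst n => pi Qd Q0.
have Qul := @det_degree _ (ulsubmx Q) (a \o lshift m2) (b \o lshift m2).
have Qdr := @det_degree _ (drsubmx Q) (a \o @rshift m1 m2) (b \o @rshift m1 m2).
rewrite -{1 2}[Q]submxK; have -> : ursubmx Q = 0.
  by apply/matrixP => i j; rewrite !mxE Q0 //= ltn_ord leq_addr.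
rewrite det_lblock mulf_eq0 negb_or => /andP[ul0 dr0].
rewrite !big_split_ord /= [X in _ <= _ + X + 1]big_pred0 => [|i]; last first.
  by rewrite ltnNge leq_addr.
rewrite addr0 [X in _ <= X + _ + 1]big_pred0 => [|i]; last first.
  by rewrite leqNgt ltn_ord.
rewrite add0r (eq_bigl predT) => [|i]; last by rewrite ltn_ord.
rewrite [X in _ \/ _ <= X + 1](eq_bigl predT) => [|i]; last by rewrite leq_addr.
have bound q m : q != 0 -> twist_stalk m Infinity q%:F -> (p %| q)%R ->
    (size p)%:Z <= m + 1.
  move=> q0 /(twist_infinity_poly _ q0) qm /(dvdp_leq q0) pq.
  by apply: le_trans qm.
have [pul _|pul] := boolP (p %| \det (ulsubmx Q))%R.
  by left; apply: (bound _ _ ul0 _ pul); apply: Qul => i l; rewrite !mxE; exact: Qd.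
rewrite Gauss_dvdpr ?irreducible_poly_coprime // => pdr.
by right; apply: (bound _ _ dr0 _ pdr); apply: Qdr => i l; rewrite !mxE; exact: Qd.
Qed.

End DetDegree.

(** * The polynomial matrix of a morphism and its determinant *)

Lemma O_sum_big (k : fieldType) n (dE : 'I_n -> int) (U : opens (P1 k)) (I : Type)
    (r : seq I) (t : I -> O_sum (fun i => O_twist k (dE i)) U) i (y : U) :
  val ((\sum_(j <- r) t j) i) y = \sum_(j <- r) val (t j i) y.
Proof.
elim: r => [|j r IHr]; first by rewrite !big_nil.
by rewrite !big_cons -IHr.
Qed.

Section Necessity.
Local Open Scope classical_set_scope.
Variables (k : finFieldType) (p : monic_irreducible k) (n : nat) (dE dE' : 'I_n -> int).
Local Notation K := (funfield k).
Local Notation E := (O_sum (fun i => O_twist k (dE i))).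
Local Notation E' := (O_sum (fun i => O_twist k (dE' i))).
Variables (phi : ohom E' E) (psi : ohom E (skyscraper (Finite p))).

Lemma affine_line_open : open (~` [set (@Infinity k)]).
Proof. by apply: cofinite_open => //; rewrite setCK; exact: finite_set1. Qed.

Definition affine_line := Opens affine_line_open.

Lemma affine_line_local m f (y : P1 k) : oset affine_line y ->
  twist_stalk m y f = local_ring y f.
Proof. by move=> y0; exact: twist_stalk_finite. Qed.

Lemma affine_line_poly a (y : P1 k) : oset affine_line y -> local_ring y a%:F.
Proof.
case: y => [|q|] // yA; first exact: local_finite_poly.
by case: (yA erefl).
Qed.

Lemma unit_vec_subproof (l i : 'I_n) (y : P1 k) : oset affine_line y ->
  twist_stalk (dE' i) y (i == l)%:R.
Proof.
move=> yA; rewrite affine_line_local //; case: eqP => _; first exact: local_ring1.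
have := twist_stalk0 0 y; by rewrite affine_line_local.
Qed.

(** All O(m) coincide with O on the affine line, so these sections form a basis of E' there. *)
Definition unit_vec l : E' affine_line := fun i => const_sec (@unit_vec_subproof l i).


Lemma affine_generic_mem : Generic \in (affine_line : set _).
Proof. by apply/mem_set => /=. Qed.

Definition affine_generic : affine_line := exist _ Generic affine_generic_mem.

Definition hom_mx : 'M[K]_n :=
  \matrix_(i, l) val (phi affine_line (unit_vec l) i) affine_generic.

(** The coordinates of s are regular functions, so s is a combination of restricted unit vectors;
    linearity and compatibility with restriction give the formula. *)
Lemma hom_mxE (V : opens (P1 k)) (h : V `<=` affine_line) (s : E' V) i (y : V) :
  val (phi V s i) y = \sum_l hom_mx i l * val (s l) y.
Proof.
have sO l : val (s l) \in @regular k V.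
  apply/asboolP/locally_fractionP; first exact: oset_open.
  split=> [z|z t]; last exact: twist_sec_const.
  rewrite -(affine_line_local (dE' l)); last exact/h/set_mem/(valP z).
  exact: twist_sec_stalk.
pose a l : structure_sheaf V := exist (fun f => f \in @regular k V) _ (sO l).
have -> : s = \sum_l a l *: res h (unit_vec l).
  apply: functional_extensionality_dep => j; apply: val_inj; apply/funext => z.
  rewrite O_sum_big (bigD1 j) //= big1 ?addr0 => [|l lj].
    by transitivity (val (s j) z * (j == j)%:R) => //; rewrite eqxx mulr1.
  by transitivity (val (s l) z * (j == l)%:R) => //; rewrite eq_sym (negPf lj) mulr0.
rewrite linear_sum O_sum_big; apply: eq_bigr => l _.
rewrite linearZ app_res O_sum_big (bigD1 l) //= big1 ?addr0 => [|j jl].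
  transitivity (val (s l) y * val (phi affine_line (unit_vec l) i) (incl h y)) => //.
  rewrite mxE mulrC (twist_sec_const _ _ affine_generic); congr (_ * _).
  by transitivity (val (s l) y * (l == l)%:R) => //; rewrite eqxx mulr1.
by transitivity (val (s j) y * (l == j)%:R) => //; rewrite eq_sym (negPf jl) mulr0.
Qed.

Lemma hom_mx_poly : exists Q : 'M[{poly k}]_n, forall i l, hom_mx i l = (Q i l)%:F.
Proof.
have /choice[q qE] : forall il : 'I_n * 'I_n, exists a, hom_mx il.1 il.2 = a%:F.
  case=> i l; apply: poly_of_local_finite => q.
  have qA : Finite q \in (affine_line : set _) by apply/mem_set.
  have := twist_sec_stalk (phi affine_line (unit_vec l) i) (exist _ (Finite q) qA).
  by rewrite mxE (twist_sec_const _ _ affine_generic).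
by exists (\matrix_(i, l) q (i, l)) => i l; rewrite (qE (i, l)) [in RHS]mxE.
Qed.

(** X^(d'_l) generates O(d'_l) at infinity, so X^(d'_l) times the unit vector l extends there. Its
    image lies in the stalk of E at infinity, and by the formula on the affine line it is X^(d'_l)
    times column l. *)
Lemma hom_mx_infinity i l : twist_stalk (dE i - dE' l) Infinity (hom_mx i l).
Proof.
pose f : K := 'X%:F ^ dE' l.
pose U := Opens (@stalk_open k (dE' l) f).
have UI : Infinity \in (U : set _).
  apply/mem_set; change (twist_stalk (dE' l) Infinity f).
  rewrite twist_stalk_infinity -expfzDr ?tofracX_neq0 // addNr expr0z.
  exact: local_ring1.
have sU j y : oset U y -> twist_stalk (dE' j) y (f * (j == l)%:R).
  by case: eqP => [->|_]; rewrite ?mulr1 ?mulr0 // => _; exact: twist_stalk0.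
pose s : E' U := fun j => const_sec (sU j).
pose V := Opens (openI (oset_open U) affine_line_open).
have VU : V `<=` U by move=> y [].
have VA : V `<=` affine_line by move=> y [].
have VG : Generic \in (V : set _) by apply/mem_set.
pose gV : V := exist _ Generic VG; pose iU : U := exist _ Infinity UI.
have := hom_mxE VA (res VU s) i gV.
rewrite app_res (bigD1 l) //= big1 ?addr0 => [|j /negPf ->]; last by rewrite !mulr0.
rewrite eqxx mulr1.
rewrite (twist_sec_const (phi U s i) _ iU) => phiE.
have := twist_sec_stalk (phi U s i) iU.
rewrite phiE !twist_stalk_infinity /f mulrCA -expfzDr ?tofracX_neq0 //.
by rewrite mulrC opprB addrC.
Qed.

Hypothesis phi_psi_exact : short_exact phi psi.

Lemma hom_mx_det (Q : 'M[{poly k}]_n) : (forall i l, hom_mx i l = (Q i l)%:F) ->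
  \det Q != 0 /\ (p %| \det Q)%R.
Proof.
case: phi_psi_exact => phi_inj psi_ker psi_onto QE; split.
  (* A polynomial null vector of Q would be a nonzero section over the affine line killed by phi. *)
  apply/negP; rewrite -det_tr => /det0P[v v0 vQ].
  case/negP: v0; apply/eqP/rowP => l.
  have vA j y : oset affine_line y -> twist_stalk (dE' j) y (v 0 j)%:F.
    by move=> yA; rewrite affine_line_local //; exact: affine_line_poly.
  pose s : E' affine_line := fun j => const_sec (vA j).
  have /phi_inj s0 : phi affine_line s = 0.
    apply: functional_extensionality_dep => i; apply: val_inj; apply/funext => y.
    rewrite (hom_mxE (fun _ => id)) /=; have /rowP/(_ i) := vQ; rewrite !mxE.
    move/(congr1 (@FracField.tofrac _)); rewrite tofrac0 rmorph_sum => vQi.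
    apply: etrans vQi; apply: eq_bigr => j _.
    by rewrite QE mxE rmorphM mulrC.
  have := congr1 (fun t : E' affine_line => val (t l) affine_generic) s0.
  rewrite /= mxE => /eqP; rewrite tofrac_eq0 => /eqP //.
have [//|pD] := boolP (p %| \det Q)%R; exfalso.
(* If p does not divide det Q, a local preimage s of 1 under psi lies in the image of phi near p, so
   psi s = 0, against 1 <> 0. *)
pose T := Opens (@openT (P1 k)).
pose one : skyscraper (Finite p) T := fun _ => 1.
have [V [h [s [Vp sE]]]] := psi_onto T one (Finite p) I.
pose D : K := 1%:F / (\det Q)%:F.
have D0 : (\det Q)%:F != 0 :> K by rewrite tofrac_neq0 (ndvd_neq0 pD).
pose W := Opens (openI (openI (oset_open V) affine_line_open) (@stalk_open k 0 D)).
have WV : W `<=` V by move=> y [[]].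
have WA : W `<=` affine_line by move=> y [[]].
have Wp : Finite p \in (W : set _).
  by apply/mem_set; split=> //=; exists 1, (\det Q).
pose pW : W := exist _ (Finite p) Wp.
(* Cramer's rule: w is Q^-1 s, regular on W because 1 / det Q is. *)
pose w l := D * \sum_i (\adj Q l i)%:F * val (s i) (incl WV pW).
have wW l y : oset W y -> twist_stalk (dE' l) y (w l).
  move=> Wy; have yA := WA _ Wy; rewrite affine_line_local //.
  rewrite -(affine_line_local (dE l)) //; apply: twist_stalk_scale.
    by rewrite -(affine_line_local 0) //; case: Wy.
  apply: twist_stalk_sum => i _; apply: twist_stalk_scale.
    exact: affine_line_poly.
  rewrite affine_line_local // -(affine_line_local (dE i)) //.
  rewrite (twist_sec_const _ _ (exist _ y (mem_set (WV _ Wy)))).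
  exact: (twist_sec_stalk (s i) (exist _ y (mem_set (WV _ Wy)))).
have adjE i j : \sum_l (Q i l)%:F * (\adj Q l j)%:F = (\det Q)%:F *+ (i == j).
  have /matrixP/(_ i j) := mul_mx_adj Q; rewrite !mxE => /(congr1 (@FracField.tofrac _)).
  by rewrite rmorph_sum tofracMn => <-; apply: eq_bigr => l _; rewrite rmorphM.
pose t : E' W := fun l => const_sec (wW l).
have tE : phi W t = res WV s.
  apply: functional_extensionality_dep => i; apply: val_inj; apply/funext => y.
  rewrite (hom_mxE WA) /= /w.
  transitivity (val (s i) (incl WV pW)); last exact: twist_sec_const.
  under eq_bigr do rewrite QE mulrCA mulr_sumr.
  rewrite -mulr_sumr exchange_big /=.
  rewrite (eq_bigr (fun j => (\det Q)%:F *+ (i == j) * val (s j) (incl WV pW))).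
    rewrite (bigD1 i) //= big1 ?addr0 => [|j /negPf ji].
      by rewrite eqxx mulrA divfK // mul1r.
    by rewrite eq_sym ji mul0r.
  by move=> j _; rewrite -adjE mulr_suml; apply: eq_bigr => l _; rewrite mulrA.
have : psi W (res WV s) = 0.
  apply/psi_ker => y Wy; exists W, (fun _ => id), t; split=> //.
  by rewrite tE res_id.
rewrite app_res sE => /(congr1 (@^~ Wp)); rewrite /= /sky_res /one /=.
by apply/eqP/oner_neq0.
Qed.

End Necessity.

(** * The modification at infinity *)

Section InfinityFacts.
Local Open Scope classical_set_scope.
Variable k : fieldType.
Local Notation K := (funfield k).

Lemma local_infinityX_le m (a b : {poly k}) : b != 0 -> m + (size a)%:Z <= (size b)%:Z ->
  local_ring Infinity ('X%:F ^ m * (a%:F / b%:F)).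
Proof.
move=> b0 ab; have [->|a0] := eqVneq a 0; last exact/local_infinityXP.
by rewrite tofrac0 mul0r mulr0; exact/local_ringP/rpred0.
Qed.

Lemma twist_infinity_poly_le m (a : {poly k}) : (size a)%:Z <= m + 1 ->
  twist_stalk m Infinity a%:F.
Proof.
have [->|a0 am] := eqVneq a 0; last exact/twist_infinity_poly.
by rewrite tofrac0 => _; exact: twist_stalk0.
Qed.

(** 1 / X is a uniformiser at infinity. *)
Lemma max_infinityP (f : K) :
  max_ideal Infinity f <-> local_ring Infinity ('X%:F * f).
Proof.
have X0 := tofracX_neq0 k.
split=> [[a [b [b0 ab ->]]]|[a [b [b0 ab fE]]]].
  exists (a * 'X), b; split=> //; last by rewrite tofracM mulrA [X in X / _]mulrC.
  by have [->|a0] := eqVneq a 0; rewrite ?mul0r ?size_poly0 // poly.size_mulX.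
exists a, (b * 'X); split; rewrite ?mulf_neq0 ?polyX_eq0 ?poly.size_mulX //.
by rewrite tofracM invfM mulrA -fE mulrC mulKf.
Qed.

End InfinityFacts.

Section HeckeAtInfinity.
Local Open Scope classical_set_scope.
Variables (k : finFieldType) (n : nat) (dE dE' : 'I_n -> int) (s : 'I_n).
Local Notation K := (funfield k).

Lemma hecke_infinity : closed [set (@Infinity k)] ->
  (forall i, dE' i = dE i - (i == s)%:Z) ->
  hecke_modification_weight1 (@Infinity k)
    (O_sum (fun i => O_twist k (dE' i))) (O_sum (fun i => O_twist k (dE i))).
Proof.
move=> cl dE'E; have X0 := tofracX_neq0 k.
have sumP (w : 'I_n -> K) i : \sum_l (1%:M : 'M[K]_n) i l * w l = w i.
  rewrite (bigD1 i) //= big1 ?addr0 => [|l /negPf li]; rewrite mxE ?eqxx ?mul1r //.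
  by rewrite eq_sym li mul0r.
(* The matrix is the identity; r reads coordinate s in the local generator X^(d_s) of O(d_s). *)
pose r i : K := (i == s)%:R * 'X%:F ^ (- dE s).
have sumr (v : 'I_n -> K) : \sum_i r i * v i = 'X%:F ^ (- dE s) * v s.
  rewrite (bigD1 s) //= big1 ?addr0 => [|l /negPf ls].
    by rewrite /r eqxx mul1r.
  by rewrite /r ls !mul0r.
have X1 (v : 'I_n -> K) :
    'X%:F * ('X%:F ^ (- dE s) * v s) = 'X%:F ^ (- dE' s) * v s.
  by rewrite mulrA dE'E eqxx opprB expfzDr // expr1z.
apply: (@hecke_of_matrix _ _ _ _ _ 1%:M r) => //.
- move=> y i l f; rewrite mxE; have [<-|_] := eqVneq i l; last first.
    by rewrite mul0r => _; exact: twist_stalk0.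
  rewrite mul1r; case: y => [|q|] //= fl; rewrite -[f]mul1r.
  apply: (twist_infinity_mul _ fl); rewrite -[1]divr1 -tofrac1.
  apply: local_infinityX_le; rewrite ?oner_neq0 // dE'E; lia.
- move=> i f; rewrite /r; have [->|_] := eqVneq i s; first by rewrite mul1r.
  by rewrite !mul0r => _; exact/local_ringP/rpred0.
- move=> w wE; under eq_bigr do rewrite sumP.
  by rewrite sumr; apply/max_infinityP; rewrite X1; exact: wE.
- exists s, ('X%:F ^ dE s); rewrite /r eqxx mul1r twist_stalk_infinity.
  rewrite -expfzDr // addNr expr0z; split=> //; exact: local_ring1.
- move=> v; exists v; split=> [i|y vE rv l]; first exact: sumP.
  case: y vE rv => [|q|] vE rv; [exact: vE | exact: vE |].
  have := rv erefl; have [->|/negPf ls] := eqVneq l s.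
    by rewrite sumr => /max_infinityP; rewrite X1.
  by move=> _; have := vE l; rewrite dE'E ls subr0.
Qed.

End HeckeAtInfinity.

(** * The modification at a finite place: the mixed radix matrix and its inverse *)

Lemma sum_telescope (V : zmodType) (f : nat -> V) (a b n : nat) : (a <= b <= n)%N ->
  \sum_(l < n | (a <= l < b)%N) (f l - f l.+1) = f a - f b.
Proof.
move=> /andP[ab bn].
rewrite -(big_mkord (fun l => a <= l < b)%N (fun l => f l - f l.+1)).
rewrite (eq_bigl (fun l => (l < b) && (a <= l))%N) => [|l]; last by rewrite andbC.
rewrite -big_nat_widenl // -(big_nat_widen _ _ _ predT) //.
apply: oppr_inj; rewrite -sumrN opprB -(telescope_sumr _ ab).
by apply: eq_bigr => l _; rewrite opprB.
Qed.

Section HeckeAtFinite.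
Local Open Scope classical_set_scope.
Variables (k : finFieldType) (p : monic_irreducible k) (n : nat).
Variables (dE dE' : 'I_n -> int) (eps : 'I_n -> nat) (s B : 'I_n).
Local Notation K := (funfield k).
Local Notation pF := ((p : {poly k})%:F : K).

Hypothesis p_closed : closed [set Finite p].
Hypothesis dE_sorted : forall i j : 'I_n, (i <= j)%N -> dE i <= dE j.
Hypothesis dE'E : forall i, dE' i = dE i - (eps i)%:Z.
Hypothesis size_p : size p = (\sum_i eps i).+1.
Hypothesis sB : (s <= B)%N.
Hypothesis eps0 : forall i : 'I_n, ~~ (s <= i <= B)%N -> eps i = 0%N.
Hypothesis interlacing : forall j j' : 'I_n, j' = j.+1 :> nat ->
  (s <= j < B)%N -> dE' j' <= dE j.

(** The exponent e_l: X^(e_l) is the place value of digit l. *)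
Definition psum (l : nat) := (\sum_(i < n | (i < l)%N) eps i)%N.

Lemma psumS (i : 'I_n) : psum i.+1 = (psum i + eps i)%N.
Proof.
rewrite /psum (bigD1 i) //= addnC; congr (_ + _)%N; apply: eq_bigl => j.
by rewrite ltnS ltn_neqAle andbC.
Qed.

Lemma psum_mono l m : (l <= m)%N -> (psum l <= psum m)%N.
Proof.
move=> lm; rewrite /psum [X in (_ <= X)%N](bigID (fun i : 'I_n => i < l)%N) /=.
rewrite (eq_bigl (fun i : 'I_n => (i < m) && (i < l))%N) ?leq_addr // => i.
by case: (ltnP i l) => il; rewrite ?andbF // (leq_trans il).
Qed.

Lemma psum_s : psum s = 0%N.
Proof. by apply: big1 => i si; apply: eps0; rewrite leqNgt si. Qed.

Lemma psum_B : psum B.+1 = (\sum_i eps i)%N.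
Proof.
rewrite [RHS](bigID (fun i : 'I_n => i < B.+1)%N) /= [X in (_ + X)%N]big1 ?addn0 //.
by move=> i; rewrite ltnS => iB; apply: eps0; rewrite (negPf iB) andbF.
Qed.

Lemma psum_size l : (l <= B.+1)%N -> (psum l < size p)%N.
Proof. by move=> lB; rewrite size_p ltnS -psum_B psum_mono. Qed.

(** Horner quotient: p stripped of the digits below place l. *)
Definition rho l : {poly k} := p %/ 'X^(psum l).

Lemma rho_s : rho s = p.
Proof. by rewrite /rho psum_s expr0 divp1. Qed.

Lemma size_rho l : size (rho l) = (size p - psum l)%N.
Proof. by rewrite size_divp ?monic_neq0 ?monicXn // size_polyXn. Qed.

(** p is monic of degree e_(B+1), so the last quotient is its leading coefficient. *)
Lemma rho_B : rho B.+1 = 1.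
Proof.
have : size (rho B.+1) = 1%N by rewrite size_rho psum_B size_p subSnn.
move=> /eqP /size_poly1P [c c0 rE].
have := divp_eq p 'X^(psum B.+1); rewrite -/(rho _) rE => pE.
have : lead_coef p = 1 by apply/eqP; rewrite -monicE mi_monic.
rewrite pE lead_coefDl; first by rewrite mul_polyC lead_coefZ lead_coefXn mulr1 => ->.
rewrite mul_polyC size_scale // size_polyXn.
by have := ltn_modpN0 p (monic_neq0 (monicXn k (psum B.+1))); rewrite size_polyXn.
Qed.

(** The difference is digit i of p, the remainder of [rho i] modulo X^(eps_i). *)
Lemma rhoS (i : 'I_n) : (size (rho i - 'X^(eps i) * rho i.+1)%R <= eps i)%N.
Proof.
have -> : rho i.+1 = rho i %/ 'X^(eps i) by rewrite /rho psumS exprD divp_divl.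
rewrite {1}(divp_eq (rho i) 'X^(eps i)) mulrC addrAC subrr add0r.
have := ltn_modpN0 (rho i) (monic_neq0 (monicXn k (eps i))).
by rewrite size_polyXn ltnS.
Qed.

(** The entry (B, B) is [rho B], that is, the last digit plus X^(eps_B), because [rho B.+1] is 1.
    Outside the range from s to B the matrix is the identity. *)
Definition hecke_poly (i l : 'I_n) : {poly k} :=
  if (s <= i < B)%N then (i == l)%:R * 'X^(eps i) - (l == i.+1 :> nat)%:R
  else if i == B then
    if (s <= l < B)%N then rho l - 'X^(eps l) * rho l.+1
    else (l == B)%:R * rho B
  else (i == l)%:R.

Definition hecke_mx : 'M[K]_n := \matrix_(i, l) (hecke_poly i l)%:F.

Definition hecke_row (j : 'I_n) : K := (if (s <= j <= B)%N then rho j.+1 else 0)%:F.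

(* p times the (l, j) entry of the inverse of the active block of [hecke_mx]. *)
Definition inv_coef (l : nat) (j : 'I_n) : {poly k} :=
  'X^(psum l) * rho j.+1 - (j < l)%:R * 'X^(psum l - psum j.+1) * p.

Definition inv_row (v : 'I_n -> K) (l : nat) : K :=
  \sum_(j : 'I_n | (s <= j <= B)%N) (inv_coef l j)%:F / pF * v j.

Lemma pF_neq0 : pF != 0.
Proof. by rewrite tofrac_neq0 irredp_neq0 //; exact: mi_irr. Qed.

(** For l < B this is row l of the system P w = v. From l to l + 1 each coefficient is multiplied by
    X^(eps_l), and the one at j = l also loses p, which cancels the denominator and leaves v_l. *)
Lemma inv_rowS v (l : 'I_n) : (s <= l <= B)%N ->
  'X%:F ^+ eps l * inv_row v l = inv_row v l.+1 + v l.
Proof.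
move=> slB; apply/eqP; rewrite addrC -subr_eq; apply/eqP.
rewrite mulr_sumr -sumrB (bigD1 l) //= big1 ?addr0 => [|j /andP[_ jl]].
  have -> : inv_coef l.+1 l = 'X^(eps l) * inv_coef l l - (p : {poly k}).
    rewrite /inv_coef ltnn ltnSn psumS subnn exprD mulr0n mulr1n expr0. ring.
  move: (inv_coef l l) => c; rewrite tofracB tofracM tofracXn !mulrBl.
  rewrite mulfV ?pF_neq0 // mul1r !mulrA.
  by rewrite opprB addrCA subrr addr0.
have -> : inv_coef l.+1 j = 'X^(eps l) * inv_coef l j.
  rewrite /inv_coef ltnS leq_eqVlt (inj_eq val_inj) (negPf jl) /= psumS exprD mulrBr.
  case: ltnP => jl'; rewrite ?mulr0n ?mulr1n; last by ring.
  by rewrite addnC -addnBA ?psum_mono // exprD; ring.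
by move: (inv_coef l j) => c; rewrite tofracM tofracXn !mulrA subrr.
Qed.

(** Equivalently, r P is p times the unit row at s. Through this identity membership of r v in the
    maximal ideal becomes regularity of w_s at p. *)
Lemma inv_row_s v : inv_row v s = (\sum_j hecke_row j * v j) / pF.
Proof.
rewrite mulr_suml [RHS](bigID (fun j : 'I_n => s <= j <= B)%N) /= [X in _ + X]big1 ?addr0.
  apply: eq_bigr => j sjB; have /andP[sj _] := sjB.
  by rewrite /hecke_row sjB /inv_coef psum_s ltnNge sj !mul0r subr0 expr0 mul1r mulrAC.
by move=> j /negPf sjB; rewrite /hecke_row sjB tofrac0 !mul0r.
Qed.

Definition inv_vec (v : 'I_n -> K) (l : 'I_n) : K :=
  if (s <= l <= B)%N then inv_row v l else v l.

Lemma hecke_mx_inv v i : \sum_l hecke_mx i l * inv_vec v l = v i.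
Proof.
have pick (c : 'I_n -> K) j : \sum_l (j == l)%:R * c l = c j.
  rewrite (bigD1 j) //= eqxx mul1r big1 ?addr0 // => l.
  by rewrite eq_sym => /negPf ->; rewrite mul0r.
under eq_bigr do rewrite mxE; rewrite /hecke_poly.
have [siB|siB] := boolP (s <= i < B)%N.
  have iB : (i.+1 < n)%N by case/andP: siB => _ iB; apply: leq_ltn_trans (ltn_ord B).
  pose i' := Ordinal iB.
  under eq_bigr do rewrite tofracB tofracM tofracXn !rmorph_nat mulrBl -mulrA.
  rewrite sumrB pick.
  rewrite (eq_bigr (fun l => (i' == l)%:R * inv_vec v l)); last first.
    by move=> l _; rewrite -val_eqE eq_sym.
  have /andP[si iB'] := siB; have siB' : (s <= i <= B)%N by rewrite si ltnW.
  have si'B : (s <= i' <= B)%N by rewrite /= leqW.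
  by rewrite pick /inv_vec siB' si'B inv_rowS //= addrC addKr.
have [->|iB] := eqVneq i B; last first.
  under eq_bigr do rewrite rmorph_nat.
  rewrite pick /inv_vec; case: ifP => // /andP[si iB'].
  by rewrite si ltn_neqAle iB iB' in siB.
rewrite (bigD1 B) //= ltnn andbF eqxx mul1r.
rewrite (bigID (fun l : 'I_n => s <= l < B)%N) /= [X in _ + (_ + X)]big1 ?addr0; last first.
  by move=> l /andP[/negPf lB /negPf ->]; rewrite lB mul0r tofrac0 mul0r.
rewrite (eq_bigl (fun l : 'I_n => s <= l < B)%N) => [|l]; last first.
  by case: eqVneq => [->|//]; rewrite ltnn andbF.
(* Row B: by the recurrence the digit terms telescope to rho_s w_s - rho_B w_B minus the sum of the
   rho_(l+1) v_l. The diagonal entry cancels rho_B w_B, and as rho_s w_s = r v only rho_(B+1) v_B =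
   v_B remains. *)
pose f l := (rho l)%:F * inv_row v l.
rewrite (eq_bigr (fun l : 'I_n => f l - f l.+1 - (rho l.+1)%:F * v l)); last first.
  move=> l slB; have /andP[sl /ltnW lB] := slB.
  rewrite slB /inv_vec sl lB /= /f -addrA -opprD -mulrDr -inv_rowS ?sl //.
  by rewrite tofracB tofracM tofracXn mulrBl mulrA [_ ^+ _ * _]mulrC.
rewrite sumrB sum_telescope ?sB ?(ltnW (ltn_ord B)) // /inv_vec sB leqnn /=.
rewrite -/(f B) addrA addrCA subrr addr0.
rewrite /f rho_s inv_row_s mulrC divfK ?pF_neq0 //.
rewrite (bigID (fun l : 'I_n => s <= l < B)%N) /= [X in _ + X - _](bigD1 B) ?ltnn ?andbF //=.
rewrite [X in _ + (_ + X) - _]big1 ?addr0 => [|l /andP[slB lB]].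
  rewrite /hecke_row sB leqnn rho_B tofrac1 mul1r addrAC -sumrB big1 ?add0r // => l.
  by case/andP=> sl lB; rewrite sl ltnW // subrr.
by rewrite /hecke_row [(l <= B)%N]leq_eqVlt (inj_eq val_inj) (negPf lB) /= (negPf slB) tofrac0 mul0r.
Qed.

(** Subtracting e_(j+1) from both sides of d_(j+1) - eps_(j+1) <= d_j shows that d_j - e_(j+1) never
    increases. *)
Lemma dE_psum_mono (l j : 'I_n) : (s <= l)%N -> (l <= j)%N -> (j <= B)%N ->
  dE j - (psum j.+1)%:Z <= dE l - (psum l.+1)%:Z.
Proof.
move=> sl lj jB.
have mono m (mn : (m < n)%N) : (l <= m)%N -> (m <= B)%N ->
    dE (Ordinal mn) - (psum m.+1)%:Z <= dE l - (psum l.+1)%:Z.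
  elim: m mn => [|m IHm] mn; rewrite leq_eqVlt => /predU1P[lm|lm] mB //.
  - by have -> : Ordinal mn = l by [exact: val_inj]; rewrite lm lexx.
  - by have -> : Ordinal mn = l by [exact: val_inj]; rewrite lm lexx.
  - have mn' := ltnW mn; apply: le_trans (IHm mn' lm (ltnW mB)).
    have := @interlacing (Ordinal mn') (Ordinal mn) erefl.
    rewrite /= (leq_trans sl lm) mB => /(_ isT).
    have := psumS (Ordinal mn); rewrite dE'E /=; lia.
have -> : j = Ordinal (ltn_ord j) by exact: val_inj.
exact: mono.
Qed.

(** The entry -1 in row i needs d'_(i+1) <= d_i, which is interlacing; digit l in row B has degree
    less than eps_l, and d_l <= d_B suffices. *)
Lemma hecke_poly_infinity i l :
  twist_stalk (dE i - dE' l) Infinity (hecke_poly i l)%:F.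
Proof.
have zero m : twist_stalk m Infinity (0 : {poly k})%:F.
  by rewrite tofrac0; exact: twist_stalk0.
rewrite /hecke_poly dE'E.
have [siB|siB] := boolP (s <= i < B)%N.
  have [<-|il] := eqVneq i l.
    rewrite ltn_eqF // subr0 mul1r; apply: twist_infinity_poly_le.
    rewrite size_polyXn; lia.
  rewrite mul0r sub0r; case: eqP => [li|_]; last by rewrite oppr0.
  apply: twist_infinity_poly_le; rewrite size_polyN size_poly1.
  have := interlacing li siB; rewrite dE'E; lia.
have [->|iB] := eqVneq i B; last first.
  have [<-|il //] := eqVneq i l; apply: twist_infinity_poly_le.
  rewrite eps0 ?size_poly1; first by lia.
  by apply: contra siB => /andP[-> iB']; rewrite ltn_neqAle iB.
have [slB|_] := boolP (s <= l < B)%N.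
  apply: twist_infinity_poly_le.
  have := rhoS l; have : dE l <= dE B by apply: dE_sorted; case/andP: slB => _ /ltnW.
  move: (size (rho l - _ * _)) => m; lia.
have [->|_] := eqVneq l B; last by rewrite mul0r.
apply: twist_infinity_poly_le.
rewrite mul1r size_rho; have := psum_B; rewrite psumS size_p => <-; lia.
Qed.

Lemma inv_coef_infinity (l j : 'I_n) : (s <= l <= B)%N -> (s <= j <= B)%N ->
  local_ring Infinity ('X%:F ^ (dE j - dE' l) * ((inv_coef l j)%:F / pF)).
Proof.
move=> /andP[sl lB] /andP[sj jB]; apply: local_infinityX_le.
  by apply: irredp_neq0; exact: mi_irr.
have pS := psumS l; have lS := @psum_size l.+1 lB; rewrite dE'E.
have jS := @psum_size j.+1 jB; rewrite /inv_coef.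
case: (ltnP j l) => jl; last first.
  have rho0 : rho j.+1 != 0 by rewrite -size_poly_gt0 size_rho subn_gt0.
  rewrite mulr0n !mul0r subr0 size_monicM ?monicXn // size_polyXn size_rho.
  have := dE_psum_mono sl jl jB; move: (size p) lS jS => ? ? ?; lia.
(* For j < l the multiples of p cancel down to the low digits of p, so the degree is less than e_l
   and sortedness suffices; for j >= l the bound was [dE_psum_mono]. *)
have -> : 'X^(psum l) * rho j.+1 - (true%:R * 'X^(psum l - psum j.+1) * p) =
    - ('X^(psum l - psum j.+1) * (p %% 'X^(psum j.+1))).
  have -> : 'X^(psum l) = 'X^(psum l - psum j.+1) * 'X^(psum j.+1) :> {poly k}.
    by rewrite -exprD subnK ?psum_mono.
  rewrite [X in _ - _ * X](divp_eq p 'X^(psum j.+1)) -/(rho j.+1) mulr1n.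
  by move: (rho j.+1) (_ %% _) => a b; ring.
have mod_size := ltn_modpN0 p (monic_neq0 (monicXn k (psum j.+1))).
rewrite size_polyXn ltnS in mod_size.
have := size_polyMleq 'X^(psum l - psum j.+1) (p %% 'X^(psum j.+1)).
set q := _ * (p %% _).
rewrite size_polyN size_polyXn; have := dE_sorted (ltnW jl); have := psum_mono jl.
move: (size p) (size (p %% _)) (size q) lS mod_size; lia.
Qed.

Lemma finite_local_inv (q : monic_irreducible k) : Finite q <> Finite p ->
  local_ring (Finite q) (pF^-1).
Proof.
move=> qp; exists 1, p; rewrite tofrac1 div1r; split=> //.
apply/negP => qdvd; apply: qp; congr Finite; apply: monic_irreducible_inj.
apply/eqP; rewrite -eqp_monic ?mi_monic //; apply: (mi_irr p).2 qdvd.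
by have [] := mi_irr q; case: ltngtP.
Qed.

(** The denominator p occurs only in the summand X^(e_l) (r v) / p; the rest is a polynomial
    combination of the v_j. *)
Lemma inv_row_local (q : monic_irreducible k) v l :
  (forall i, local_ring (Finite q) (v i)) ->
  (Finite q = Finite p -> max_ideal (Finite q) (\sum_j hecke_row j * v j)) ->
  local_ring (Finite q) (inv_row v l).
Proof.
move=> vq rvq.
have rv : local_ring (Finite q) ((\sum_j hecke_row j * v j) / pF).
  have [qp|/finite_local_inv pq] := pselect (Finite q = Finite p).
    by case: qp (rvq qp) => -> /max_finiteP.
  apply: (@local_ringM _ (Finite q)) pq; apply: local_ring_sum => j _.
  apply: (@local_ringM _ (Finite q)) (vq j); exact: local_finite_poly.
have -> : inv_row v l = ('X^(psum l))%:F * ((\sum_j hecke_row j * v j) / pF) -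
    \sum_(j : 'I_n | (s <= j <= B)%N) ((j < l)%:R * 'X^(psum l - psum j.+1))%:F * v j.
  rewrite -inv_row_s mulr_sumr -sumrB; apply: eq_bigr => j /andP[sj _].
  rewrite /inv_coef psum_s [(j < s)%N]ltnNge sj expr0 mul1r mulr0n !mul0r subr0.
  set a := rho _; set b := (_ * 'X^_).
  by rewrite tofracB !tofracM !mulrBl mulfK ?pF_neq0 // !mulrA.
apply: local_ringB.
  by apply: (@local_ringM _ (Finite q)) rv; exact: local_finite_poly.
apply: local_ring_sum => j _.
apply: (@local_ringM _ (Finite q)) (vq j); exact: local_finite_poly.
Qed.

Theorem hecke_finite : hecke_modification_weight1 (Finite p)
  (O_sum (fun i => O_twist k (dE' i))) (O_sum (fun i => O_twist k (dE i))).
Proof.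
have P_onto (v : 'I_n -> K) : exists w : 'I_n -> K,
    (forall i, \sum_l hecke_mx i l * w l = v i) /\
    forall y, (forall i, twist_stalk (dE i) y (v i)) ->
      (y = Finite p -> max_ideal (Finite p) (\sum_i hecke_row i * v i)) ->
      forall l, twist_stalk (dE' l) y (w l).
  exists (inv_vec v); split=> [i|y vE rv l]; first exact: hecke_mx_inv.
  rewrite /inv_vec; case: ifPn => [slB|slB]; last first.
    by have := vE l; rewrite dE'E (eps0 slB) subr0.
  case: y vE rv => [|q|] // vE rv.
    by apply: inv_row_local => // qp; rewrite qp; exact: rv.
  apply: twist_stalk_sum => j sjB.
  by apply: twist_infinity_mul (vE j); exact: inv_coef_infinity.
apply: (@hecke_of_matrix _ _ _ _ _ hecke_mx hecke_row) => //.
- move=> y i l f; rewrite mxE; case: y => [|q|] // fl.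
    by apply: twist_stalk_scale => //; exact: local_finite_poly.
  apply: (twist_infinity_mul _ fl); rewrite -opprB -twist_stalk_infinity.
  exact: hecke_poly_infinity.
- move=> i f fi; apply: (@local_ringM _ (Finite p)) fi; exact: local_finite_poly.
- move=> w wE; set v := fun i => \sum_l hecke_mx i l * w l.
  (* By injectivity w is the explicit inverse of v = P w, so w_s = (r v) / p, and w_s is regular at
     p. *)
  have wv : w =1 inv_vec v.
    move=> l; apply/eqP; rewrite -subr_eq0; apply/eqP.
    apply: (mx_inj_of_onto P_onto (w := fun l => w l - inv_vec v l)) => i.
    under eq_bigr do rewrite mulrBr.
    by rewrite sumrB hecke_mx_inv subrr.
  apply/max_finiteP; rewrite -inv_row_s.
  by have := wE s; rewrite wv /inv_vec leqnn sB.
(* Coordinate B of r is rho_(B+1) = 1. *)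
- exists B, 1; split; first exact: local_ring1.
  by rewrite /hecke_row leqnn sB rho_B tofrac1 mulr1.
Qed.

End HeckeAtFinite.

(** * Necessity of the inequalities, and the equivalence *)

(** The complement would be a nonempty open set missing the generic point. *)
Lemma generic_not_closed (k : fieldType) : ~ closed [set (@Generic k)]%classic.
Proof.
rewrite -openC => oG.
by have [] := @open_generic _ _ Infinity oG.
Qed.

Lemma interlacing_of_hecke (k : finFieldType) (p : monic_irreducible k) (n : nat)
    (dE dE' : 'I_n -> int) (eps : 'I_n -> nat) (j j' : 'I_n) :
  (forall i l : 'I_n, (i <= l)%N -> dE i <= dE l) ->
  (forall i l : 'I_n, (i <= l)%N -> dE' i <= dE' l) ->
  (forall i, dE' i = dE i - (eps i)%:Z) ->
  size p = (\sum_i eps i).+1 ->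
  (exists2 s : 'I_n, (s <= j)%N & eps s != 0%N) ->
  (exists2 B : 'I_n, (j' <= B)%N & eps B != 0%N) ->
  j' = j.+1 :> nat ->
  hecke_modification_weight1 (Finite p)
    (O_sum (fun i => O_twist k (dE' i))) (O_sum (fun i => O_twist k (dE i))) ->
  dE' j' <= dE j.
Proof.
move=> dE_sorted dE'_sorted dE'E szp [s sj s0] [B jB B0] jj' [phi [psi ex]].
rewrite leNgt; apply/negP => dEj.
have [Q QE] := hom_mx_poly phi.
have [D0 pD] := hom_mx_det ex QE.
have Qinf i l : twist_stalk (dE i - dE' l) Infinity (Q i l)%:F.
  by rewrite -QE; exact: hom_mx_infinity.
(* As d'_(j+1) > d_j, sortedness makes the degree bound negative for rows up to j and columns beyond
   j. *)
have Q0 (i l : 'I_n) : (i < j.+1 <= l)%N -> Q i l = 0.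
  rewrite ltnS -jj' => /andP[ij jl]; apply/eqP; apply: contraT => Qn0.
  have /(twist_infinity_poly _ Qn0) := Qinf i l.
  have := dE_sorted _ _ ij; have := dE'_sorted _ _ jl.
  move: Qn0; rewrite -size_poly_gt0; move: (size (Q i l)); lia.
have nE : n = (j.+1 + (n - j.+1))%N by rewrite subnKC.
have epsE (P : pred 'I_n) :
    \sum_(i | P i) (dE i - dE' i) = (\sum_(i | P i) eps i)%N%:Z.
  by rewrite raddf_sum; apply: eq_bigr => i _; rewrite dE'E subKr.
have sum_split : (\sum_i eps i = \sum_(i < n | i < j.+1) eps i +
    \sum_(i < n | j.+1 <= i) eps i)%N.
  rewrite (bigID (fun i : 'I_n => i < j.+1)%N) /=; congr (_ + _)%N.
  by apply: eq_bigl => i; rewrite -leqNgt.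
(* The first block contains s and the second B, so each partial sum is less than deg p. *)
have low : (0 < \sum_(i < n | i < j.+1) eps i)%N.
  by rewrite (bigD1 s) ?ltnS //= addn_gt0 lt0n s0.
have high : (0 < \sum_(i < n | j.+1 <= i) eps i)%N.
  by rewrite (bigD1 B) -?jj' //= addn_gt0 lt0n B0.
have := lower_block_degree nE (mi_irr p) Qinf Q0 D0 pD.
rewrite !epsE szp sum_split; move: low high.
move: (\sum_(i < n | i < j.+1) eps i)%N (\sum_(i < n | j.+1 <= i) eps i)%N.
lia.
Qed.

Theorem theorem3 (k : finFieldType) (x : P1 k) (d : nat)
  (x_closed : closed [set x]%classic)
  (x_degree : has_degree x d)
  (n : nat) (dE dE' : 'I_n -> int)
  (dE_sorted : forall i j : 'I_n, (i <= j)%N -> dE i <= dE j)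
  (dE'_sorted : forall i j : 'I_n, (i <= j)%N -> dE' i <= dE' j)
  (eps : 'I_n -> nat)
  (eps_le : forall i, (eps i <= d)%N)
  (dE'_eps : forall i, dE' i = dE i - (eps i)%:Z)
  (eps_sum : (\sum_i eps i = d)%N)
  (A : {set 'I_n}) (A_def : forall i, i \in A <-> eps i <> 0%N)
  (s B : 'I_n)
  (s_min : s \in A /\ forall i, i \in A -> (s <= i)%N)
  (B_max : B \in A /\ forall i, i \in A -> (i <= B)%N) :
  hecke_modification_weight1 x
    (O_sum (fun i => O_twist k (dE' i))) (O_sum (fun i => O_twist k (dE i)))
  <->
  (forall j j' : 'I_n, j' = j.+1 :> nat -> (s <= j)%N -> (j < B)%N ->
     dE j' - (eps j')%:Z <= dE j).
Proof.
have [/A_def/eqP s0 sA] := s_min; have [/A_def/eqP B0 BA] := B_max.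
have sB : (s <= B)%N by apply/sA/A_def/eqP.
have eps0 (i : 'I_n) : ~~ (s <= i <= B)%N -> eps i = 0%N.
  by apply: contraNeq => /eqP/A_def iA; rewrite sA ?BA.
case: x x_closed x_degree => [|p|] x_closed x_degree.
- by have := generic_not_closed x_closed.
- have sp := degree_finite x_degree; rewrite -eps_sum in sp; split.
    move=> hecke j j' jj' sj jB; rewrite -dE'_eps.
    apply: (interlacing_of_hecke dE_sorted dE'_sorted dE'_eps sp _ _ jj' hecke).
      by exists s.
    by exists B; rewrite ?jj'.
  move=> inter; apply: (hecke_finite x_closed dE_sorted dE'_eps sp sB eps0).
  by move=> j j' jj' /andP[sj jB]; rewrite dE'_eps; exact: inter.
- have d1 := degree_infinity x_degree.
  (* With total 1 and eps_s nonzero, eps is the indicator of s; hence B = s and no j is left to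
     test. *)
  have epsE i : eps i = (i == s).
    have := eps_sum; rewrite d1 (bigD1 s) //=; have [->|is_] := eqVneq i s; first by lia.
    by rewrite (bigD1 i) //=; move: s0; rewrite -lt0n; lia.
  have BsE : B = s by apply/eqP; move: B0; rewrite epsE; case: (B == s).
  split=> _; first by move=> j j' _ sj; rewrite BsE ltnNge sj.
  by apply: (@hecke_infinity _ _ _ _ s) => // i; rewrite dE'_eps epsE.
Qed.
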